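(* Let $p\in[1,\infty)$ and let $\mu,\nu\in P_p(\mathbb{R}^d)$ be two probability measures sharing the same copula. For $i=1,\dots,d$, denote by $F_i$ and $G_i$ the distribution functions of the $i$-th one-dimensional margins of $\mu$ and $\nu$, respectively. Let $W_p$ be the $p$-Wasserstein distance on $\mathbb{R}^d$ with respect to the $p$-norm. Then $$(W_p(\mu,\nu))^p=\sum_{i=1}^d\int_{\mathbb{R}}\int_{\mathbb{R}}|x_i-y_i|^p\,dM(F_i(x_i),G_i(y_i)),$$ where $M(u,v)=\min(u,v)$ is the two-dimensional comonotonicity copula.
   Context: For $r\in[1,\infty)$, $\|x\|_r=(\sum_{i=1}^d|x_i|^r)^{1/r}$ on $\mathbb{R}^d$. $P_p(\mathbb{R}^d)$ is the set of Borel probability measures $\mu$ on $\mathbb{R}^d$ with $\int_{\mathbb{R}^d}\|x\|_p^p\,\mu(dx)<\infty$. A coupling of $\mu$ and $\nu$ is a Borel probability measure $\pi$ on $\mathbb{R}^d\times\mathbb{R}^d$ with $\pi(A\times\mathbb{R}^d)=\mu(A)$ and $\pi(\mathbb{R}^d\times A)=\nu(A)$ for all Borel $A\subseteq\mathbb{R}^d$; $\Pi(\mu,\nu)$ denotes the set of all couplings. The $p$-Wasserstein distance with the $p$-norm is defined by $$(W_p(\mu,\nu))^p=\inf_{\pi\in\Pi(\mu,\nu)}\int_{\mathbb{R}^d\times\mathbb{R}^d}\|x-y\|_p^p\,\pi(dx,dy).$$ A $d$-dimensional copula is a function $C:[0,1]^d\to[0,1]$ such that: (1) $C(u)=0$ whenever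 some $u_i=0$; (2) for all $a,b\in[0,1]^d$ with $a_i\le b_i$ for all $i$, $\sum_{i_1=1}^2\cdots\sum_{i_d=1}^2(-1)^{i_1+\cdots+i_d}C(u_{1i_1},\dots,u_{di_d})\ge0$, where $u_{j1}=a_j$, $u_{j2}=b_j$; (3) $C(1,\dots,1,u_i,1,\dots,1)=u_i$ for all $i$ and all $u_i\in[0,1]$. The joint distribution function of $\mu$ is $H_\mu(x_1,\dots,x_d)=\mu(\prod_{i=1}^d(-\infty,x_i])$. The measures $\mu$ and $\nu$, with one-dimensional marginal distribution functions $F_1,\dots,F_d$ and $G_1,\dots,G_d$ respectively, share the same copula if there exists a $d$-dimensional copula $C$ such that, for all $x,y\in\mathbb{R}^d$, $H_\mu(x_1,\dots,x_d)=C(F_1(x_1),\dots,F_d(x_d))$ and $H_\nu(y_1,\dots,y_d)=C(G_1(y_1),\dots,G_d(y_d))$. The comonotonicity copula is $M:[0,1]^2\to[0,1]$, $M(u,v)=\min(u,v)$. For distribution functions $F,G$ on $\mathbb{R}$, $(x,y)\mapsto M(F(x),G(y))$ is a joint distribution function on $\mathbb{R}^2$ with margins $F$ and $G$, and $\int_{\mathbb{R}}\int_{\mathbb{R}}g(x,y)\,dM(F(x),G(y))$ denotes the integral of $g$ with respect to the probability measure on $\mathbb{R}^2$ having this distribution function. *)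

(* Defs.v *)
From HB Require Import structures.
From mathcomp Require Import all_boot all_order all_algebra.
From mathcomp Require Import all_classical all_reals all_analysis.

Set Implicit Arguments.
Unset Strict Implicit.
Unset Printing Implicit Defensive.

Import Order.TTheory GRing.Theory Num.Theory.

Local Open Scope classical_set_scope.
Local Open Scope ring_scope.

(* R^d is d.-tuple R: its canonical sigma-algebra, generated by the
   coordinates, is the Borel sigma-algebra of R^d. *)

Definition lpnorm (R : realType) (d : nat) (r : R) (x : d.-tuple R) : R :=
  (\sum_(i < d) `|tnth x i| `^ r) `^ r^-1.

Definition vsub (R : realType) (d : nat) (x y : d.-tuple R) : d.-tuple R :=
  [tuple tnth x i - tnth y i | i < d].

Definition finite_moment (R : realType) (d : nat) (p : R)
    (mu : probability (d.-tuple R) R) : Prop :=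
  (\int[mu]_x (lpnorm p x `^ p)%:E < +oo)%E.

Definition coupling (R : realType) (d : nat)
    (mu nu : probability (d.-tuple R) R)
    (pi : probability (d.-tuple R * d.-tuple R)%type R) : Prop :=
  forall A : set (d.-tuple R), measurable A ->
    pi (A `*` [set: d.-tuple R]) = mu A /\ pi ([set: d.-tuple R] `*` A) = nu A.

(* The p-th root of the optimal transport cost; valued in \bar R, so that no
   finiteness is built into the definition. *)
Definition wasserstein (R : realType) (d : nat) (p : R)
    (mu nu : probability (d.-tuple R) R) : \bar R :=
  (poweR (ereal_inf
    [set \int[pi]_z (lpnorm p (vsub z.1 z.2) `^ p)%:E | pi in coupling mu nu])
    p^-1)%E.

Definition in_cube (R : realType) (d : nat) (u : d.-tuple R) : Prop :=
  forall i : 'I_d, 0 <= tnth u i <= 1.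

(* A copula is represented by a total function of which only the restriction
   to [0,1]^d matters. In copula_increasing, e k = false selects the index
   i_k = 1 (the corner a) and e k = true selects i_k = 2 (the corner b). *)
Record is_copula (R : realType) (d : nat) (C : d.-tuple R -> R) : Prop := {
  copula_range : forall u, in_cube u -> 0 <= C u <= 1;
  copula_grounded : forall u, in_cube u ->
    (exists i : 'I_d, tnth u i = 0) -> C u = 0;
  copula_increasing : forall a b, in_cube a -> in_cube b ->
    (forall i : 'I_d, tnth a i <= tnth b i) ->
    0 <= \sum_(e : {ffun 'I_d -> bool})
           (-1) ^+ (\sum_(k < d) (e k).+1)%N
             * C [tuple (if e k then tnth b k else tnth a k) | k < d];
  copula_margin : forall (i : 'I_d) (t : R), 0 <= t <= 1 ->
    C [tuple (if j == i then t else 1) | j < d] = t }.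

Definition joint_df (R : realType) (d : nat) (mu : probability (d.-tuple R) R)
    (x : d.-tuple R) : R :=
  fine (mu [set z | forall i : 'I_d, tnth z i <= tnth x i]).

Definition coord (R : realType) (d : nat) (i : 'I_d) (x : d.-tuple R) : R :=
  tnth x i.

HB.instance Definition _ (R : realType) (d : nat) (i : 'I_d) :=
  isMeasurableFun.Build _ _ (d.-tuple R) R (@coord R d i) (measurable_tnth i).

Definition margin_df (R : realType) (d : nat) (mu : probability (d.-tuple R) R)
    (i : 'I_d) (t : R) : R :=
  fine (cdf (coord i : {RV mu >-> R}) t).

Definition share_copula (R : realType) (d : nat)
    (mu nu : probability (d.-tuple R) R) : Prop :=
  exists C : d.-tuple R -> R, [/\ is_copula C,
    forall x, joint_df mu x = C [tuple margin_df mu i (tnth x i) | i < d] &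
    forall y, joint_df nu y = C [tuple margin_df nu i (tnth y i) | i < d]].

Definition comonotonicity (R : realType) (u v : R) : R := Num.min u v.

(* The probability measure on R^2 whose joint distribution function is
   (x, y) |-> H x y (a default value if there is no such measure). *)
Definition measure_of_df2 (R : realType) (H : R -> R -> R) :
    probability (R * R)%type R :=
  get [set m : probability (R * R)%type R |
    forall x y : R, m (`]-oo, x] `*` `]-oo, y]) = (H x y)%:E].

Definition comonotone_measure (R : realType) (F G : R -> R) :
    probability (R * R)%type R :=
  measure_of_df2 (fun x y => comonotonicity (F x) (G y)).

(* Main.v *)
(* Let U be a random vector whose joint distribution function is the common
   copula C, and let X_i and Y_i be the quantile transforms of U_i for F_i and
   G_i. Then (X, Y) is a coupling of mu and nu whose i-th coordinate pair has
   distribution function min(F_i(x), G_i(y)), so its cost is the right-hand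
   side. Conversely, the cost of any coupling splits over the coordinates, and
   each coordinate pair has a joint distribution function at most
   min(F_i(x), G_i(y)); since |x - y|^p is submodular, among the laws on R^2
   with given margins the pointwise larger distribution function has the
   smaller cost.

   U is obtained without a multivariate extension theorem. The C-volumes of the
   dyadic subcubes of [0,1]^d form consistent weights on a 2^d-ary tree, and
   nested subintervals of [0,1) of these lengths define a random branch of the
   tree, that is, a random decreasing sequence of dyadic cubes, which shrinks
   to U. *)

Require Import Defs.
From HB Require Import structures.
From mathcomp Require Import all_boot all_order all_algebra.
From mathcomp Require Import all_classical all_reals all_analysis.
From mathcomp Require Import measurable_realfun ring lra.

Set Implicit Arguments.
Unset Strict Implicit.
Unset Printing Implicit Defensive.

Import Order.TTheory GRing.Theory Num.Theory.
Import numFieldNormedType.Exports.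

Local Open Scope classical_set_scope.
Local Open Scope ring_scope.

(** * Random branches of a weighted tree *)

Section finite_subdivision.
Context (R : realType) (B : finType).

(** Left endpoint of the interval of [b] when [[0, \sum_c f c)] is cut into consecutive half-open
    intervals of lengths [f c], in the order of [enum_rank]. *)
Definition below (f : B -> R) (b : B) : R :=
  \sum_(c | (enum_rank c < enum_rank b)%N) f c.

Lemma below_add_le (f : B -> R) (b c : B) : (forall x, 0 <= f x) ->
  (enum_rank b < enum_rank c)%N -> below f b + f b <= below f c.
Proof.
move=> f0 bc; rewrite /below [leRHS](bigD1 b bc)/= [leLHS]addrC lerD2l.
rewrite [leRHS]big_mkcond [leLHS]big_mkcond/=; apply: ler_sum => x _.
case: ifPn => xb; last by case: ifPn.
by rewrite (ltn_trans xb bc)/= ifT//; apply: contraTneq xb => ->; rewrite ltnn.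
Qed.

Lemma below_add_le_sum (f : B -> R) (b : B) : (forall x, 0 <= f x) ->
  below f b + f b <= \sum_c f c.
Proof.
move=> f0; rewrite /below [leRHS](bigD1 b)//= [leLHS]addrC lerD2l.
rewrite [leRHS]big_mkcond [leLHS]big_mkcond/=; apply: ler_sum => x _.
case: ifPn => xb; last by case: ifPn.
by rewrite ifT//; apply: contraTneq xb => ->; rewrite ltnn.
Qed.

Lemma below_exists (f : B -> R) (t : R) : 0 <= t < \sum_c f c ->
  exists b, below f b <= t < below f b + f b.
Proof.
move=> /andP[t0 t1].
(* [G j] is the weight of the first [j] letters. At the least [j] with [t < G j], the last letter
   counted is the one sought. *)
pose G j := \sum_(c | (enum_rank c < j)%N) f c.
have GN : G #|B| = \sum_c f c by apply: eq_bigl => c; rewrite ltn_ord.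
have ex : exists j, t < G j by exists #|B|; rewrite GN.
case: (ex_minnP ex) => -[|j] tG mj.
  by move: tG; rewrite /G big_pred0// => t0'; move: (lt_le_trans t0' t0); rewrite ltxx.
have jB : (j < #|B|)%N by apply: mj; rewrite GN.
exists (enum_val (Ordinal jB)).
have -> : below f (enum_val (Ordinal jB)) = G j by rewrite /below enum_valK.
apply/andP; split.
  by rewrite leNgt; apply/negP => /mj; rewrite ltnn.
apply: (lt_le_trans tG); rewrite /G (bigD1 (enum_val (Ordinal jB)))/=; last first.
  by rewrite enum_valK/=.
rewrite addrC lerD2r le_eqVlt; apply/orP; left; apply/eqP.
apply: eq_bigl => c; rewrite ltnS leq_eqVlt.
have [->|cn] := eqVneq c (enum_val (Ordinal jB)).
  by rewrite enum_valK/= ltnn andbF.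
rewrite andbT; case: eqP => //= cj; exfalso; move/eqP: cn; apply.
by rewrite -[c]enum_rankK; congr enum_val; exact: ord_inj.
Qed.

End finite_subdivision.

Section tree_process.
Context (R : realType) (B : finType) (b0 : B) (w : seq B -> R).
Hypothesis w_ge0 : forall s, 0 <= w s.
Hypothesis w_nil : w [::] = 1.
Hypothesis w_rcons : forall s, w s = \sum_b w (rcons s b).

Let child s b := w (rcons s b).

(** A word [s] owns the interval [[left s, left s + w s)], which the intervals of its one-letter
    extensions subdivide; the empty word owns [[0, 1)]. *)
Let left s : R := \sum_(i < size s) below (child (take i s)) (nth b0 s i).

Let left_rcons s b : left (rcons s b) = left s + below (child s) b.
Proof.
rewrite /left size_rcons big_ord_recr/= -cats1 take_size_cat// nth_cat ltnn subnn/=.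
congr (_ + _); apply: eq_bigr => i _.
by rewrite takel_cat 1?ltnW// nth_cat ltn_ord.
Qed.

Let cell s t := (left s <= t) && (t < left s + w s).

Let cell_rcons s b t : cell (rcons s b) t -> cell s t.
Proof.
rewrite /cell left_rcons => /andP[h1 h2]; apply/andP; split.
  by apply: le_trans h1; rewrite lerDl sumr_ge0// => *; exact: w_ge0.
apply: (lt_le_trans h2); rewrite -addrA lerD2l [leRHS]w_rcons.
by apply: (below_add_le_sum b (f := child s)) => x; exact: w_ge0.
Qed.

Let cell01 s t : cell s t -> 0 <= t < 1.
Proof.
elim/last_ind: s => [|s b ih]; last by move/cell_rcons/ih.
by rewrite /cell /left big_ord0 w_nil add0r.
Qed.

Let cell_inj s s' t : size s = size s' -> cell s t -> cell s' t -> s = s'.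
Proof.
elim/last_ind: s s' => [|s b ih] s'; first by case: s'.
case/lastP: s' => [|s' b']; first by rewrite size_rcons.
rewrite !size_rcons => -[ss] cs cs'.
have E := ih _ ss (cell_rcons cs) (cell_rcons cs'); subst s'; congr rcons.
move: cs cs'; rewrite /cell !left_rcons => /andP[h1 h2] /andP[h3 h4].
have w0 x : 0 <= child s x by exact: w_ge0.
suff /eqP rbb : nat_of_ord (enum_rank b) == enum_rank b'.
  exact: (enum_rank_inj (ord_inj rbb)).
rewrite eqn_leq; apply/andP; split; rewrite leqNgt; apply/negP => bb.
  have := lt_le_trans h4 (le_trans _ h1); rewrite ltxx -addrA lerD2l.
  by rewrite (below_add_le w0 bb) => /(_ isT).
have := lt_le_trans h2 (le_trans _ h3); rewrite ltxx -addrA lerD2l.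
by rewrite (below_add_le w0 bb) => /(_ isT).
Qed.

Let cell_step s t : cell s t -> exists b, cell (rcons s b) t.
Proof.
rewrite /cell -{1}(addr0 (left s)) w_rcons -lerBrDl -ltrBlDl.
move=> /(@below_exists R B (child s))[b /andP[bt tb]]; exists b.
by rewrite left_rcons -lerBrDl bt/= -addrA -ltrBlDl.
Qed.

(** At each level the branch of [t] enters the child interval containing [t]. The default [b0] is
    taken only for [t] outside [[0, 1)], a null set for the uniform law. *)
Fixpoint tree_path (n : nat) (t : measurableTypeR R) : seq B :=
  if n isn't n'.+1 then [::] else
  let s := tree_path n' t in
  rcons s (odflt b0 [pick b | cell (rcons s b) t]).

Let size_tree_path n t : size (tree_path n t) = n.
Proof. by elim: n => //= n ih; rewrite size_rcons ih. Qed.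

Let tree_path_cell n t : 0 <= t < 1 -> cell (tree_path n t) t.
Proof.
move=> t01; elim: n => [|n ih] /=.
  by rewrite /cell /left big_ord0 w_nil add0r.
by case: pickP => //= nob; have [b] := cell_step ih; rewrite nob.
Qed.

Let tree_path_out n t : ~~ (0 <= t < 1) -> tree_path n t = nseq n b0.
Proof.
move=> t01; elim: n => [//|n ih] /=.
case: pickP => [b /cell01|_/=]; first by rewrite (negbTE t01).
by rewrite ih; elim: (n) => //= k ->.
Qed.

Let cellE s : [set t | cell s t] = `[left s, left s + w s[%classic.
Proof. by apply/seteqP; split => t /=; rewrite in_itv. Qed.

(** Points outside [[0, 1)] all follow the constant word [nseq n b0], so only the preimage of that
    word gets an extra piece. *)
Let tree_path_preim n s : size s = n ->
  tree_path n @^-1` [set s] = `[left s, left s + w s[%classic `|`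
    (if s == nseq n b0 then ~` `[0, 1[%classic else set0).
Proof.
move=> ns; rewrite -cellE; apply/seteqP; split => t /=.
- move=> <-; have [t01|t01] := boolP (0 <= t < 1).
    by left; exact: tree_path_cell.
  by right; rewrite (tree_path_out _ t01) eqxx/= in_itv/=; exact/negP.
- case=> [cs|].
    apply: (@cell_inj _ _ t) => //; first by rewrite size_tree_path.
    by apply: tree_path_cell; exact: cell01 cs.
  case: eqP => //= -> /negP; rewrite in_itv/= => t01.
  exact: tree_path_out.
Qed.

Let measurable_tree_path n s : measurable (tree_path n @^-1` [set s]).
Proof.
have [ns|ns] := eqVneq (size s) n.
  rewrite tree_path_preim//; apply: measurableU => //.
  by case: ifP => // _; apply: measurableC.
rewrite (_ : _ @^-1` _ = set0)//; apply/seteqP; split => // t /= ts.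
by move/eqP: ns; rewrite -ts size_tree_path.
Qed.

Let P : probability (measurableTypeR R) R := uniform_prob (@ltr01 R).

Let uniform_prob_co (a b : R) : 0 <= a -> a <= b -> b <= 1 ->
  P `[a, b[%classic = (b - a)%:E.
Proof.
move=> a0 ab b1; rewrite /P/= /uniform_prob integral_uniform_pdf setIidl; last first.
  move=> x /=; rewrite !in_itv/= => /andP[ax xb].
  by rewrite (le_trans a0 ax) (le_trans (ltW xb)).
rewrite (eq_integral (cst 1%:E)); last first.
  move=> x; rewrite inE/= in_itv/= => /andP[ax xb].
  by rewrite /uniform_pdf (le_trans a0 ax) (le_trans (ltW xb))//= subr0 invr1.
rewrite integral_cst//= mul1e lebesgue_measure_itv/= lte_fin.
by case: ltgtP ab => // ->; rewrite subrr.
Qed.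

Let tree_path_prob n s : size s = n ->
  P (tree_path n @^-1` [set s]) = (w s)%:E.
Proof.
move=> ns.
(* Intervals of words stay inside [[0, 1]], where the uniform probability of an interval is its
   length. *)
have cs : 0 <= left s /\ left s + w s <= 1.
  split; first by apply: sumr_ge0 => i _; apply: sumr_ge0 => *; exact: w_ge0.
  clear ns; elim/last_ind: s => [|s b ih]; first by rewrite /left big_ord0 w_nil add0r.
  apply: le_trans ih; rewrite left_rcons -addrA lerD2l [leRHS]w_rcons.
  by apply: (below_add_le_sum b (f := child s)) => x; exact: w_ge0.
have PI : P `[left s, left s + w s[%classic = (w s)%:E.
  by case: cs => c1 c2; rewrite uniform_prob_co// ?lerDl ?w_ge0// addrC addKr.
rewrite tree_path_preim// -PI; apply/eqP; rewrite eq_le; apply/andP; split.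
  apply: (le_trans (measureU2 _ _ _)) => //.
    by case: ifP => // _; apply: measurableC.
  rewrite [X in (_ + X)%E](_ : _ = 0%E) ?adde0//.
  case: ifP => // _; rewrite [LHS]probability_setC// uniform_prob_co//.
  by rewrite subr0 subee.
apply: le_measure; rewrite ?inE//; apply: measurableU => //.
by case: ifP => // _; apply: measurableC.
Qed.

Lemma tree_process : exists d (T : measurableType d) (P : probability T R)
    (K : nat -> T -> seq B), forall n,
  [/\ forall t, size (K n t) = n,
      forall t, exists b, K n.+1 t = rcons (K n t) b,
      forall s, measurable (K n @^-1` [set s]) &
      forall s, size s = n -> P (K n @^-1` [set s]) = (w s)%:E].
Proof.
exists _, _, P, tree_path => n; split.
- exact: size_tree_path.
- by move=> t; eexists.
- exact: measurable_tree_path.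
- exact: tree_path_prob.
Qed.

End tree_process.

(** * Volumes of boxes and dyadic cells under a copula *)

Section copula_volume.
Context (R : realType) (d : nat) (C : d.-tuple R -> R).

Definition box_volume (a b : d.-tuple R) : R :=
  \sum_(e : {ffun 'I_d -> bool}) (-1) ^+ (\sum_(k < d) (e k).+1)%N
    * C [tuple (if e k then tnth b k else tnth a k) | k < d].

Let sg (x : bool) : R := (-1) ^+ x.+1.

Let signE (e : 'I_d -> bool) :
  (-1) ^+ (\sum_(k < d) (e k).+1)%N = \prod_k sg (e k) :> R.
Proof. by rewrite /sg prodrXr. Qed.

(** In one coordinate cut at m, [c] selects the lower or upper piece and [e] an endpoint of that
    piece. [Some e] is an endpoint of the whole interval and [None] is the cut point, reached twice
    with opposite signs. *)
Let half (c e : bool) : option bool := if c == e then Some e else None.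

Let sum_half (o : option bool) :
  \sum_(x : bool * bool | half x.1 x.2 == o) sg x.2 = if o is Some e then sg e else 0.
Proof.
rewrite big_mkcond/= -(pair_bigA _ (fun c e => if half c e == o then sg e else 0))/=.
rewrite !big_bool/= /half/= /sg/=.
by case: o => [[]|] /=; rewrite ?addr0 ?add0r// expr1 expr2 mulN1r opprK addrC subrr.
Qed.

(* Writing the sum over the corners of all sub-boxes as a sum over maps to
   {a, m, b}, the signs of the corners having a coordinate in m cancel. *)
Lemma box_volume_split (a m b : d.-tuple R) :
  box_volume a b = \sum_(c : {ffun 'I_d -> bool})
    box_volume [tuple (if c k then tnth m k else tnth a k) | k < d]
               [tuple (if c k then tnth b k else tnth m k) | k < d].
Proof.
pose pt (o : option bool) k :=
  match o with Some true => tnth b k | Some false => tnth a k | None => tnth m k end.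
pose G (s : {ffun 'I_d -> option bool}) := C [tuple pt (s k) k | k < d].
transitivity (\sum_(s : {ffun 'I_d -> option bool})
    (\prod_k (if s k is Some e then sg e else 0)) * G s).
  rewrite [RHS](bigID (fun s : {ffun 'I_d -> option bool} => [forall k, s k != None]))/=.
  rewrite [X in _ + X]big1 ?addr0; last first.
    move=> s; rewrite negb_forall => /existsP[k]; rewrite negbK => /eqP sk.
    by rewrite (bigD1 k)//= sk !mul0r.
  rewrite (reindex_onto (fun e : {ffun 'I_d -> bool} => [ffun k => Some (e k)])
    (fun s : {ffun 'I_d -> option bool} => [ffun k => odflt false (s k)]))/=; last first.
    move=> s /forallP sN; apply/ffunP => k; rewrite !ffunE.
    by case: (s k) (sN k).
  rewrite [RHS](eq_bigl xpredT); last first.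
    move=> e; apply/andP; split; first by apply/forallP => k; rewrite ffunE.
    by apply/eqP/ffunP => k; rewrite !ffunE.
  apply: eq_bigr => e _; rewrite signE; congr (_ * _).
    by apply: eq_bigr => k _; rewrite ffunE.
  congr C; apply: eq_from_tnth => k; rewrite !tnth_mktuple ffunE/=.
  by case: (e k).
under eq_bigr => s _.
  rewrite (eq_bigr (fun k => \sum_(x : bool * bool | half x.1 x.2 == s k) sg x.2)); last first.
    by move=> k _; rewrite sum_half.
  rewrite (bigA_distr_big_dep (fun k x => half x.1 x.2 == s k) (fun _ x => sg x.2))/= mulr_suml.
  over.
rewrite /= (exchange_big_dep xpredT)//=.
transitivity (\sum_(h : {ffun 'I_d -> bool * bool})
    (\prod_k sg (h k).2) * G [ffun k => half (h k).1 (h k).2]).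
  apply: eq_bigr => h _; rewrite (big_pred1 [ffun k => half (h k).1 (h k).2])//.
  move=> s /=; apply/familyP/eqP => [sh|-> k]; last by rewrite ffunE unfold_in.
  by apply/ffunP => k; rewrite ffunE; move: (sh k); rewrite unfold_in => /eqP.
rewrite [RHS]pair_bigA/=.
rewrite (reindex (fun p : {ffun 'I_d -> bool} * {ffun 'I_d -> bool} =>
   [ffun k => (p.1 k, p.2 k)]))/=; last first.
  exists (fun h : {ffun 'I_d -> bool * bool} => ([ffun k => (h k).1], [ffun k => (h k).2])).
    by move=> [p q] _; congr pair; apply/ffunP => k; rewrite !ffunE.
  by move=> h _; apply/ffunP => k; rewrite !ffunE -surjective_pairing.
apply: eq_bigr => -[c e] _ /=; rewrite signE; congr (_ * _).
  by apply: eq_bigr => k _; rewrite ffunE.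
congr C; apply: eq_from_tnth => k; rewrite !tnth_mktuple !ffunE /half/=.
by case: (c k); case: (e k).
Qed.

(** Exchanging the two choices in coordinate [i] keeps the corner but reverses its sign, so the
    volume equals its own opposite. *)
Lemma box_volume_degenerate (a b : d.-tuple R) (i : 'I_d) :
  tnth a i = tnth b i -> box_volume a b = 0.
Proof.
move=> abi.
pose flip (e : {ffun 'I_d -> bool}) := [ffun k => if k == i then ~~ e k else e k].
suff : box_volume a b = - box_volume a b by lra.
rewrite {1}/box_volume (reindex flip)/=; last first.
  by exists flip => e _; apply/ffunP => k; rewrite !ffunE; case: eqP => //; rewrite negbK.
rewrite /box_volume -sumrN; apply: eq_bigr => e _; rewrite !signE -mulNr; congr (_ * C _).
  rewrite [LHS](bigD1 i)//= [in RHS](bigD1 i)//= -mulNr; congr (_ * _).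
    by rewrite ffunE eqxx /sg; case: (e i) => /=; rewrite expr1 expr2 mulN1r opprK.
  by apply: eq_bigr => k /negbTE ki; rewrite ffunE ki.
apply: eq_from_tnth => k; rewrite !tnth_mktuple ffunE.
by case: eqP => // ->; case: (e i); rewrite /= abi.
Qed.

Hypothesis hC : is_copula C.

Lemma box_volume_ge0 (a b : d.-tuple R) : in_cube a -> in_cube b ->
  (forall i, tnth a i <= tnth b i) -> 0 <= box_volume a b.
Proof. exact: copula_increasing. Qed.

(** Every corner other than [u] takes some coordinate from the origin, where [C] vanishes by
    groundedness; the sign at [u] is an even power of -1. *)
Lemma box_volume_origin (u : d.-tuple R) : in_cube u ->
  box_volume [tuple 0 | _ < d] u = C u.
Proof.
move=> uc; rewrite /box_volume (bigD1 [ffun=> true])//= [X in _ + X]big1 ?addr0; last first.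
  move=> e /eqP eT; rewrite (copula_grounded hC) ?mulr0//.
    move=> i; rewrite tnth_mktuple; case: (e i); first exact: uc.
    by rewrite tnth_mktuple lexx ler01.
  have /forallPn[k ek] : ~~ [forall k, e k].
    by apply/negP => /forallP h; apply: eT; apply/ffunP => k; rewrite ffunE h.
  by exists k; rewrite tnth_mktuple (negbTE ek) tnth_mktuple.
rewrite (eq_bigr (fun=> 2%N)); last by move=> k _; rewrite ffunE.
rewrite sum_nat_const mulnC exprM expr2 mulN1r opprK expr1n mul1r.
by congr C; apply: eq_from_tnth => k; rewrite tnth_mktuple ffunE.
Qed.

(** Cutting at [m] makes the smaller box one of the summands, and the others are nonnegative. *)
Lemma box_volume_subbox (a m b : d.-tuple R) : in_cube a -> in_cube b ->
  (forall i, tnth a i <= tnth m i <= tnth b i) -> box_volume a m <= box_volume a b.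
Proof.
move=> ac bc amb; have mc : in_cube m.
  move=> i; have /andP[am mb] := amb i.
  case/andP: (ac i) => a0 _; case/andP: (bc i) => _ b1.
  by rewrite (le_trans a0 am) (le_trans mb b1).
rewrite (box_volume_split a m b) (bigD1 [ffun=> false])//=.
rewrite [X in box_volume X _ + _](_ : _ = a); last first.
  by apply: eq_from_tnth => k; rewrite tnth_mktuple ffunE.
rewrite [X in box_volume _ X + _](_ : _ = m); last first.
  by apply: eq_from_tnth => k; rewrite tnth_mktuple ffunE.
rewrite lerDl sumr_ge0// => c _; apply: box_volume_ge0 => k; rewrite !tnth_mktuple.
- by case: (c k); [exact: mc|exact: ac].
- by case: (c k); [exact: bc|exact: mc].
- by case: (c k); case/andP: (amb k).
Qed.

End copula_volume.

Lemma big_tuple_rcons (R : nmodType) (B : finType) (n : nat) (F : seq B -> R) :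
  \sum_(s : n.+1.-tuple B) F s = \sum_(s : n.-tuple B) \sum_b F (rcons s b).
Proof.
rewrite pair_bigA/= (reindex (fun p : n.-tuple B * B => [tuple of rcons p.1 p.2]))//.
apply: onW_bij; apply: inj_card_bij => [[s b] [t c] /= /(congr1 val)/= /rcons_inj[]|].
  by move=> /val_inj -> ->.
by rewrite card_prod !card_tuple expnSr.
Qed.

Section dyadic_cells.
Context (R : realType) (d : nat).
Local Notation letter := {ffun 'I_d -> bool}.

(** In each coordinate, [s] is read as a binary expansion: the letter at position [j] supplies the
    digit of weight [2 ^- j.+1]. A word thus names a dyadic cube of side [2 ^- size s]. *)
Definition dyadic_lo (s : seq letter) : d.-tuple R :=
  [tuple \sum_(j < size s) (nth [ffun=> false] s j i)%:R / 2 ^+ j.+1 | i < d].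

Definition dyadic_hi (s : seq letter) : d.-tuple R :=
  [tuple tnth (dyadic_lo s) i + 2 ^- size s | i < d].

Lemma dyadic_lo_rcons s b i : tnth (dyadic_lo (rcons s b)) i =
  tnth (dyadic_lo s) i + (b i)%:R / 2 ^+ (size s).+1.
Proof.
rewrite !tnth_mktuple size_rcons big_ord_recr/=; congr (_ + _); last first.
  by rewrite nth_rcons ltnn eqxx.
by apply: eq_bigr => j _; rewrite nth_rcons ltn_ord.
Qed.

Lemma dyadic_hi_rcons s b i : tnth (dyadic_hi (rcons s b)) i =
  tnth (dyadic_lo s) i + (b i).+1%:R / 2 ^+ (size s).+1.
Proof.
rewrite tnth_mktuple dyadic_lo_rcons size_rcons -addrA; congr (_ + _).
by rewrite -[X in _ + X]mul1r -mulrDl natr1.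
Qed.

Lemma pow2SV n : 2 ^- n = 2 / 2 ^+ n.+1 :> R.
Proof. by rewrite exprS invfM mulrA divff ?mul1r. Qed.

Lemma pow2V_ge0 n : 0 <= 2 ^- n :> R.
Proof. by rewrite invr_ge0 exprn_ge0. Qed.

Lemma dyadic_lo_ge0 s i : 0 <= tnth (dyadic_lo s) i.
Proof. by rewrite tnth_mktuple sumr_ge0// => j _; rewrite mulr_ge0// pow2V_ge0. Qed.

Lemma dyadic_le s i : tnth (dyadic_lo s) i <= tnth (dyadic_hi s) i.
Proof. by rewrite [leRHS]tnth_mktuple lerDl pow2V_ge0. Qed.

Lemma dyadic_lo_rcons_le s b i : tnth (dyadic_lo s) i <= tnth (dyadic_lo (rcons s b)) i.
Proof. by rewrite dyadic_lo_rcons lerDl mulr_ge0// pow2V_ge0. Qed.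

Lemma dyadic_hi_rcons_le s b i : tnth (dyadic_hi (rcons s b)) i <= tnth (dyadic_hi s) i.
Proof.
rewrite dyadic_hi_rcons [leRHS]tnth_mktuple lerD2l (pow2SV (size s)) ler_wpM2r ?pow2V_ge0//.
by rewrite ler_nat; case: (b i).
Qed.

Lemma dyadic_hi_le1 s i : tnth (dyadic_hi s) i <= 1.
Proof.
elim/last_ind: s => [|s b ih]; last by apply: le_trans ih; exact: dyadic_hi_rcons_le.
by rewrite !tnth_mktuple big_ord0 add0r expr0 invr1.
Qed.

Lemma dyadic_lo_cube s : in_cube (dyadic_lo s).
Proof. by move=> i; rewrite dyadic_lo_ge0 (le_trans (dyadic_le s i)) ?dyadic_hi_le1. Qed.

Lemma dyadic_hi_cube s : in_cube (dyadic_hi s).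
Proof. by move=> i; rewrite (le_trans _ (dyadic_le s i)) ?dyadic_lo_ge0 ?dyadic_hi_le1. Qed.

Definition tmin (a u : d.-tuple R) : d.-tuple R :=
  [tuple Num.min (tnth a i) (tnth u i) | i < d].

Lemma tnth_tmin (a u : d.-tuple R) i :
  tnth (tmin a u) i = Num.min (tnth a i) (tnth u i).
Proof. exact: tnth_mktuple. Qed.

Lemma tmin_idl (a u : d.-tuple R) : (forall i, tnth a i <= tnth u i) -> tmin a u = a.
Proof.
by move=> au; apply: eq_from_tnth => i; rewrite tnth_mktuple; apply/min_idPl.
Qed.

Context (C : d.-tuple R -> R) (hC : is_copula C).

Definition cell_mass (s : seq letter) : R := box_volume C (dyadic_lo s) (dyadic_hi s).

(** Mass of the part of the cell lying in the box from 0 to [u]. If the cell misses that box,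
    truncating its corners collapses a side and the volume is 0. *)
Let cut_mass (u : d.-tuple R) s : R :=
  box_volume C (tmin (dyadic_lo s) u) (tmin (dyadic_hi s) u).

(** Truncation commutes with halving: cutting the truncated cell at its truncated centre yields
    exactly the truncated children. *)
Let cut_mass_rcons u s : cut_mass u s = \sum_b cut_mass u (rcons s b).
Proof.
pose m : d.-tuple R := [tuple tnth (dyadic_lo s) i + 2 ^- (size s).+1 | i < d].
rewrite /cut_mass (box_volume_split _ _ (tmin m u)); apply: eq_bigr => b _.
have mE k : tnth m k = tnth (dyadic_lo s) k + 2 ^- (size s).+1 by rewrite tnth_mktuple.
have hiE k : tnth (dyadic_hi s) k = tnth (dyadic_lo s) k + 2 ^- size s.
  by rewrite tnth_mktuple.
congr box_volume; apply: eq_from_tnth => k; rewrite tnth_mktuple !tnth_tmin.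
  by rewrite dyadic_lo_rcons mE; case: (b k); rewrite /= ?mul0r ?mul1r ?addr0.
rewrite dyadic_hi_rcons mE hiE.
by case: (b k); rewrite /= ?mul0r ?mul1r ?addr0// -pow2SV.
Qed.

Lemma cell_mass_ge0 s : 0 <= cell_mass s.
Proof.
apply: box_volume_ge0 => //; [exact: dyadic_lo_cube|exact: dyadic_hi_cube|].
exact: dyadic_le.
Qed.

Let cell_massE s : cell_mass s = cut_mass [tuple 1 | _ < d] s.
Proof.
rewrite /cut_mass !tmin_idl// => i; rewrite [leRHS]tnth_mktuple ?dyadic_hi_le1//.
by case/andP: (dyadic_lo_cube s i).
Qed.

Lemma cell_mass_rcons s : cell_mass s = \sum_b cell_mass (rcons s b).
Proof. by rewrite cell_massE cut_mass_rcons; apply: eq_bigr => b _; rewrite cell_massE. Qed.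

Let cut_mass_nil u : in_cube u -> cut_mass u [::] = C u.
Proof.
move=> uc; rewrite -(box_volume_origin hC uc); congr box_volume.
  apply: eq_from_tnth => i; rewrite !tnth_mktuple big_ord0; apply/min_idPl.
  by case/andP: (uc i).
apply: eq_from_tnth => i; rewrite !tnth_mktuple big_ord0 add0r expr0 invr1.
by apply/min_idPr; case/andP: (uc i).
Qed.

Let sum_cut_mass u n : in_cube u -> \sum_(s : n.-tuple letter) cut_mass u s = C u.
Proof.
move=> uc; elim: n => [|n ih].
  rewrite (big_pred1 [tuple]) ?cut_mass_nil// => s.
  by apply/esym/eqP/val_inj; rewrite /= (size0nil (size_tuple s)).
by rewrite big_tuple_rcons -ih; apply: eq_bigr => s _; rewrite -cut_mass_rcons.
Qed.

Let tmin_cube (a u : d.-tuple R) : in_cube a -> in_cube u -> in_cube (tmin a u).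
Proof.
move=> ac uc i; rewrite tnth_mktuple.
by have [] := leP (tnth a i) (tnth u i) => _; [exact: ac|exact: uc].
Qed.

Let cut_mass_ge0 u s : in_cube u -> 0 <= cut_mass u s.
Proof.
move=> uc; apply: box_volume_ge0 => //.
- by apply: tmin_cube => //; exact: dyadic_lo_cube.
- by apply: tmin_cube => //; exact: dyadic_hi_cube.
- move=> i; rewrite !tnth_tmin le_min !ge_min lexx orbT andbT.
  by rewrite dyadic_le.
Qed.

Definition tle (a b : d.-tuple R) : bool := [forall i, tnth a i <= tnth b i].

(* Only the cells crossing the boundary of the box [0,u] are counted differently
   by this bound and the next one. *)
Lemma cell_mass_hi_le u n : in_cube u ->
  \sum_(s : n.-tuple letter | tle (dyadic_hi s) u) cell_mass s <= C u.
Proof.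
move=> uc; rewrite -(sum_cut_mass n uc) big_mkcond/=; apply: ler_sum => s _.
case: ifPn => [/forallP h|_]; last exact: cut_mass_ge0.
rewrite /cut_mass !tmin_idl// => i.
by rewrite (le_trans (dyadic_le s i)).
Qed.

Lemma cell_mass_lo_ge u n : in_cube u ->
  C u <= \sum_(s : n.-tuple letter | tle (dyadic_lo s) u) cell_mass s.
Proof.
move=> uc; rewrite -(sum_cut_mass n uc) [leRHS]big_mkcond/=; apply: ler_sum => s _.
case: ifPn => [/forallP h|/forallPn[i]]; rewrite /cut_mass.
  rewrite (tmin_idl h); apply: (box_volume_subbox hC).
  - exact: dyadic_lo_cube.
  - exact: dyadic_hi_cube.
  - by move=> i; rewrite tnth_tmin le_min dyadic_le h ge_min lexx.
(* The cell starts beyond [u] in coordinate [i], so both truncated corners have [i]-th coordinate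
   [tnth u i]. *)
rewrite -ltNge => ui; rewrite (@box_volume_degenerate _ _ _ _ _ i)//.
rewrite !tnth_tmin; apply/eqP.
by rewrite !min_r// ?(ltW ui)// (le_trans (ltW ui) (dyadic_le s i)).
Qed.

Lemma cell_mass_nil : cell_mass [::] = C [tuple 1 | _ < d].
Proof. by rewrite cell_massE cut_mass_nil// => i; rewrite tnth_mktuple ler01 lexx. Qed.

End dyadic_cells.

(** * A random vector distributed according to a copula *)

Lemma measurable_fun_lray d (T : measurableType d) (R : realType) (f : T -> R) :
  (forall x, measurable (f @^-1` `]-oo, x]%classic)) -> measurable_fun setT f.
Proof.
move=> mf; apply: (measurability _ (RGenOInfty.measurableE R)) => _ [_ [x ->] <-].
by rewrite setTI -setCitvl preimage_setC; apply: measurableC; exact: mf.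
Qed.

Section copula_law.
Context (R : realType) (d : nat) (C : d.-tuple R -> R).
Hypothesis hC : is_copula C.
Local Notation letter := {ffun 'I_d -> bool}.

Context (dO : measure_display) (O : measurableType dO) (P : probability O R).
Context (K : nat -> O -> seq letter).
Hypothesis size_K : forall n t, size (K n t) = n.
Hypothesis K_rcons : forall n t, exists b, K n.+1 t = rcons (K n t) b.
Hypothesis measurable_K : forall n s, measurable (K n @^-1` [set s]).
Hypothesis P_K : forall n s, size s = n -> P (K n @^-1` [set s]) = (cell_mass C s)%:E.

Let event n (A : pred (seq letter)) :
  [set t | A (K n t)] = \bigcup_(s in [set s : n.-tuple letter | A s]) K n @^-1` [set val s].
Proof.
apply/seteqP; split => t /=.
  by move=> At; exists (Tuple (introT eqP (size_K n t))).
by move=> [s /= As ts]; rewrite /= ts.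
Qed.

Let measurable_event n (A : pred (seq letter)) : measurable [set t | A (K n t)].
Proof. by rewrite event; apply: fin_bigcup_measurable => // s _. Qed.

Let P_event n (A : pred (seq letter)) :
  P [set t | A (K n t)] = (\sum_(s : n.-tuple letter | A s) cell_mass C s)%:E.
Proof.
rewrite event measure_fin_bigcup//=; last first.
  by move=> s s' _ _ [t [/= ts ts']]; apply/val_inj; exact: etrans (esym ts) ts'.
rewrite -(@bigfs _ _ _ _ (index_enum _) (fun s : n.-tuple letter => A s)); first last.
- by move=> s _; rewrite mem_index_enum.
- exact: index_enum_uniq.
by rewrite -sumEFin; apply: eq_bigr => s _; rewrite P_K ?size_tuple.
Qed.

Let lo n i t := tnth (dyadic_lo R (K n t)) i.
Let hi n i t := tnth (dyadic_hi R (K n t)) i.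

Let lo_nd i t : {homo (fun n => lo n i t) : m n / (m <= n)%N >-> m <= n}.
Proof.
apply: homo_leq => [//|m n p|n]; first exact: le_trans.
by rewrite /lo; have [b ->] := K_rcons n t; exact: dyadic_lo_rcons_le.
Qed.

Let hi_ni i t : {homo (fun n => hi n i t) : m n / (m <= n)%N >-> n <= m}.
Proof.
apply: homo_leq => [//|m n p mn np|n]; first exact: le_trans np mn.
by rewrite /hi; have [b ->] := K_rcons n t; exact: dyadic_hi_rcons_le.
Qed.

Let lo_le_hi i t m n : lo m i t <= hi n i t.
Proof.
apply: (le_trans (lo_nd i t (leq_maxl m n))).
apply: le_trans (hi_ni i t (leq_maxr m n)); exact: dyadic_le.
Qed.

Let hiE n i t : hi n i t = lo n i t + 2 ^- n.
Proof. by rewrite /hi tnth_mktuple size_K. Qed.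

(** In each coordinate the cells are nested intervals of length [2 ^- n]; this supremum is the point
    to which they shrink. *)
Let V i t := sup (range (fun n => lo n i t)).

Let lo_le_V n i t : lo n i t <= V i t.
Proof.
apply: ub_le_sup; last by exists n.
by exists (hi 0 i t) => _ [m _ <-].
Qed.

Let V_le x i t : (forall n, lo n i t <= x) -> V i t <= x.
Proof. by move=> h; apply: ge_sup; [exists (lo 0 i t), 0%N|move=> _ [n _ <-]]. Qed.

Let V_le_hi n i t : V i t <= hi n i t.
Proof. exact: V_le. Qed.

Let V_preim x i : V i @^-1` `]-oo, x]%classic = \bigcap_n [set t | lo n i t <= x].
Proof.
apply/seteqP; split => t /=; rewrite in_itv/=.
  by move=> h n _; exact: le_trans h.
by move=> h; apply: V_le => n; exact: h.
Qed.

Let measurable_V i : measurable_fun setT (V i).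
Proof.
apply: measurable_fun_lray => x; rewrite V_preim; apply: bigcapT_measurable => n.
exact: (measurable_event n (fun s => tnth (dyadic_lo R s) i <= x)).
Qed.

Let mV_le i x : measurable [set t | V i t <= x].
Proof. by rewrite -[X in measurable X]setTI; exact: measurable_fun_le. Qed.

Let mV_lt i x : measurable [set t | V i t < x].
Proof.
rewrite (_ : mkset _ = V i @^-1` `]-oo, x[%classic); last first.
  by apply/seteqP; split => t /=; rewrite in_itv.
by rewrite -[X in measurable X]setTI; exact: measurable_V.
Qed.

Let mV_eq i x : measurable [set t | V i t = x].
Proof.
rewrite (_ : mkset _ = V i @^-1` [set x])//.
by rewrite -[X in measurable X]setTI; exact: measurable_V.
Qed.

Let le01 i t : 0 <= V i t <= 1.
Proof.
apply/andP; split; first exact: le_trans (dyadic_lo_ge0 R _ i) (lo_le_V 0 i t).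
exact: le_trans (V_le_hi 0 i t) (dyadic_hi_le1 R _ i).
Qed.

Let all_meas (A : 'I_d -> set O) : (forall i, measurable (A i)) ->
  measurable [set t | forall i, A i t].
Proof.
move=> mA; rewrite (_ : mkset _ = \bigcap_(i in setT) A i); last first.
  by apply/seteqP; split => t h i; [move=> _|]; exact: h.
exact: fin_bigcap_measurable.
Qed.

(** [V] lies below [u] exactly when all lower corners do. These decreasing events each have
    probability at least [C u] by [cell_mass_lo_ge], and continuity from above concludes. *)
Let copula_le u : in_cube u -> ((C u)%:E <= P [set t | forall i, (V i t <= tnth u i)%R])%E.
Proof.
move=> uc; pose F n := [set t | tle (dyadic_lo R (K n t)) u].
have mF n : measurable (F n) := measurable_event n (fun s => tle (dyadic_lo R s) u).
have -> : [set t | forall i, V i t <= tnth u i] = \bigcap_n F n.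
  apply/seteqP; split => t /= h.
    by move=> n _; apply/forallP => i; exact: le_trans (lo_le_V n i t) (h i).
  by move=> i; apply: V_le => n; exact: (forallP (h n I)).
have niF : nonincreasing_seq F.
  move=> m n mn; rewrite subsetEset => t /forallP h; apply/forallP => i.
  exact: le_trans (lo_nd i t mn) (h i).
have cv : P \o F @ \oo --> P (\bigcap_n F n).
  apply: nonincreasing_cvg_mu => //; first by rewrite -ge0_fin_numE// fin_num_measure.
  exact: bigcapT_measurable.
apply: (cvge_to_ge cv); near=> n.
by rewrite /= (P_event n (fun s => tle (dyadic_lo R s) u)) lee_fin cell_mass_lo_ge.
Unshelve. all: by end_near. Qed.

Let mV_lt1 (u : d.-tuple R) :
  measurable [set t | forall i, V i t < tnth u i \/ tnth u i = 1].
Proof.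
apply: (all_meas (A := fun i t => V i t < tnth u i \/ tnth u i = 1)) => i.
have [u1|u1] := pselect (tnth u i = 1).
  by rewrite [X in measurable X](_ : _ = setT)//; apply/seteqP; split => // t _; right.
rewrite [X in measurable X](_ : _ = [set t | V i t < tnth u i])//.
by apply/seteqP; split => t /=; [case|left].
Qed.

(* The clause [tnth u i = 1] makes the bound usable for the margins, where the
   other coordinates of V are unconstrained and may equal 1. *)
Let le_copula u : in_cube u ->
  (P [set t | forall i, (V i t < tnth u i)%R \/ tnth u i = 1%R] <= (C u)%:E)%E.
Proof.
move=> uc; pose F n := [set t | tle (dyadic_hi R (K n t)) u].
have mF n : measurable (F n) := measurable_event n (fun s => tle (dyadic_hi R s) u).
have ndF : nondecreasing_seq F.
  move=> m n mn; rewrite subsetEset => t /forallP h; apply/forallP => i.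
  exact: le_trans (hi_ni i t mn) (h i).
have cv : P \o F @ \oo --> P (\bigcup_n F n).
  by apply: nondecreasing_cvg_mu => //; exact: bigcupT_measurable.
apply: (@le_trans _ _ (P (\bigcup_n F n))); last first.
  apply: (cvge_to_le cv); near=> n.
  by rewrite /= (P_event n (fun s => tle (dyadic_hi R s) u)) lee_fin cell_mass_hi_le.
apply: le_measure; rewrite ?inE.
- exact: mV_lt1.
- exact: bigcupT_measurable.
- move=> t /= h.
  (* Where [V] is strictly below [u], a cell of side less than the gap ends below [u]; where the
     bound is 1, level 0 suffices. The largest of these levels serves all coordinates. *)
  have : forall i, exists n, hi n i t <= tnth u i.
    move=> i; have [Vu|->] := h i; last by exists 0%N; exact: dyadic_hi_le1.
    have uV : 0 < tnth u i - V i t by rewrite subr_gt0.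
    have [n _ /(_ n (leqnn n))/= un] := near_infty_natSinv_expn_lt (PosNum uV).
    exists n; rewrite hiE; move: (lo_le_V n i t) un; rewrite /= div1r; lra.
  move=> /choice[N hN]; exists (\max_i N i)%N => //; apply/forallP => i.
  by apply: le_trans (hN i); apply: hi_ni; exact: leq_bigmax.
Unshelve. all: by end_near. Qed.

Let single (i : 'I_d) (x : R) : d.-tuple R := [tuple (if j == i then x else 1) | j < d].

Let single_cube i x : 0 <= x <= 1 -> in_cube (single i x).
Proof. by move=> x01 j; rewrite tnth_mktuple; case: ifP => // _; rewrite ler01 lexx. Qed.

Let V_lt i x : 0 <= x <= 1 -> (P [set t | (V i t < x)%R] <= x%:E)%E.
Proof.
move=> x01; rewrite -[leRHS](congr1 EFin (copula_margin hC i x01)).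
apply: le_trans (le_copula (single_cube i x01)); apply: le_measure; rewrite ?inE//.
move=> t /= Vx j; rewrite tnth_mktuple; case: eqP => [->|_]; [by left|by right].
Qed.

Let V_ge i x : 0 <= x <= 1 -> (x%:E <= P [set t | (V i t <= x)%R])%E.
Proof.
move=> x01; rewrite -[leLHS](congr1 EFin (copula_margin hC i x01)).
apply: (le_trans (copula_le (single_cube i x01))); apply: le_measure; rewrite ?inE//.
  by apply: (all_meas (A := fun j t => V j t <= tnth (single i x) j)) => j; exact: mV_le.
by move=> t /= /(_ i); rewrite tnth_mktuple eqxx.
Qed.

(** Approaching [x] from above in [V_lt] and from below in [V_ge] gives P(V <= x) <= x <= P(V < x),
    so no mass is left at [x]. *)
Let V_eq0 i x : P [set t | V i t = x] = 0%E.
Proof.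
have [x01|x01] := boolP (0 <= x <= 1); last first.
  rewrite (_ : mkset _ = set0) ?measure0//; apply/seteqP; split => // t /= Vx.
  by move: x01; rewrite -Vx le01.
have Vle : (P [set t | (V i t <= x)%R] <= x%:E)%E.
  have [x1|x1] := ltP x 1; last first.
    apply: (le_trans (probability_le1 P _)) => //.
  apply/lee_addgt0Pr => e e0; rewrite -EFinD.
  (* The minimum keeps the argument of [V_lt] in [[0, 1]], and [x < 1] keeps it strictly above
     [x]. *)
  have m01 : 0 <= Num.min (x + e) 1 <= 1.
    by rewrite ge_min lexx orbT andbT le_min ler01 andbT; case/andP: x01; lra.
  apply: (@le_trans _ _ (Num.min (x + e) 1)%:E); last by rewrite lee_fin ge_min lexx.
  apply: le_trans (V_lt i m01); apply: le_measure; rewrite ?inE// => t /= Vx.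
  by rewrite lt_min (le_lt_trans Vx)//= ?(le_lt_trans Vx)// ltrDl.
have Vge : (x%:E <= P [set t | (V i t < x)%R])%E.
  have [x0|x0] := leP x 0; first by apply: (@le_trans _ _ 0%E); rewrite ?lee_fin.
  apply/lee_addgt0Pr => e e0; rewrite -leeBlDr// -EFinB.
  have m01 : 0 <= Num.max (x - e) 0 <= 1.
    by rewrite le_max lexx orbT ge_max ler01 andbT; case/andP: x01; lra.
  apply: (@le_trans _ _ (Num.max (x - e) 0)%:E); first by rewrite lee_fin le_max lexx.
  apply: (le_trans (V_ge i m01)); apply: le_measure; rewrite ?inE// => t /= Vx.
  by apply: (le_lt_trans Vx); rewrite gt_max x0 andbT ltrBlDr ltrDl.
have Veq : P [set t | V i t <= x] = (P [set t | (V i t < x)%R] + P [set t | V i t = x])%E.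
  rewrite -measureU//; last by apply/seteqP; split => // t /= [] /[swap] ->; rewrite ltxx.
  congr (P _); apply/seteqP; split => t /=; rewrite le_eqVlt.
    by move=> /orP[/eqP|]; [right|left].
  by move=> [->|->]; rewrite ?eqxx ?orbT.
apply/eqP; rewrite eq_le measure_ge0 andbT.
have fl : P [set t | V i t < x] \is a fin_num by rewrite fin_num_measure.
rewrite -(leeD2lE _ _ fl) adde0 -Veq; exact: le_trans Vge.
Qed.

Lemma copula_law_of_branch : exists U : O -> d.-tuple R,
  [/\ measurable_fun setT U, forall t i, 0 < tnth (U t) i < 1 &
  forall u, in_cube u -> P [set t | tle (U t) u] = (C u)%:E].
Proof.
(* Quantiles behave well only at levels strictly between 0 and 1, so the values 0 and 1, taken with
   probability 0, are moved to an arbitrary interior point. *)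
pose W i t := if 0 < V i t < 1 then V i t else 2^-1.
have mW i : measurable_fun setT (W i).
  apply: measurable_fun_ifT => //.
  by apply: measurable_and; apply: measurable_fun_ltr => //.
exists (fun t => [tuple W i t | i < d]); split.
- apply/measurable_fun_tnthP => i; rewrite (_ : _ \o _ = W i)//.
  by apply/funext => t /=; rewrite tnth_mktuple.
- move=> t i; rewrite tnth_mktuple /W; case: ifP => // _.
  by apply/andP; split; lra.
move=> u uc.
(* Outside these null sets [W] equals [V], and the weak and strict comparisons of [V] with [u]
   agree, so that [copula_le] and [le_copula] meet. *)
pose N i := [set t | V i t = 0] `|` [set t | V i t = 1] `|` [set t | V i t = tnth u i].
have mN i : measurable (N i).
  exact: (measurableU _ _ (measurableU _ _ (mV_eq i 0) (mV_eq i 1)) (mV_eq i (tnth u i))).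
have N0 i : P (N i) = 0%E.
    rewrite measureU0; [| |exact: mV_eq|exact: V_eq0].
    by rewrite measureU0; [|exact: mV_eq|exact: mV_eq|exact: V_eq0]; exact: V_eq0.
  by apply: measurableU; exact: mV_eq.
have mbN : measurable (\bigcup_i N i) by exact: fin_bigcup_measurable.
have PN : P (\bigcup_i N i) = 0%E.
  apply/eqP; rewrite eq_le measure_ge0 andbT.
  have := @content_sub_fsum _ _ _ P _ setT (\bigcup_i N i) N finite_finset.
  by rewrite fsbig1; [apply=> // i _; exact: mN|move=> i _; exact: N0].
have le_null A B : measurable A -> measurable B -> A `<=` B `|` \bigcup_i N i ->
    (P A <= P B)%E.
  move=> mA mB AB; apply: (@le_trans _ _ (P (B `|` \bigcup_i N i))).
    by apply: le_measure; rewrite ?inE//; exact: measurableU.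
  by apply: (le_trans (measureU2 _ _ _)) => //; rewrite [X in (_ + X)%E]PN adde0.
pose A := [set t | forall i, V i t <= tnth u i].
have mA : measurable A by apply: (all_meas (A := fun i t => V i t <= tnth u i)) => i; exact: mV_le.
have PA : P A = (C u)%:E.
  apply/eqP; rewrite eq_le copula_le// andbT; apply: le_trans (le_copula uc).
  apply: le_null => //.
  move=> t At; have [[i Ni]|nN] := pselect (exists i, N i t); first by right; exists i.
  left => i; left; rewrite lt_neqAle At andbT; apply/eqP => Vu; apply: nN.
  by exists i; right.
have mA' : measurable [set t | tle [tuple W i t | i < d] u].
  rewrite (_ : mkset _ = [set t | forall i, W i t <= tnth u i]); last first.
    apply/seteqP; split => t /=.
      by move=> /forallP h i; move: (h i); rewrite tnth_mktuple.
    by move=> h; apply/forallP => i; rewrite tnth_mktuple.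
  apply: (all_meas (A := fun i t => W i t <= tnth u i)) => i.
  by rewrite -[X in measurable X]setTI; exact: measurable_fun_le.
have WV t i : ~ (exists i, N i t) -> W i t = V i t.
  move=> nN; rewrite /W; case: ifPn => //; rewrite negb_and -!leNgt => h.
  exfalso; apply: nN; exists i; left; case/orP: h => h; [left|right]; apply/eqP.
    by rewrite eq_le h; case/andP: (le01 i t).
  by rewrite eq_le h andbT; case/andP: (le01 i t).
rewrite -PA; apply/eqP; rewrite eq_le; apply/andP; split; apply: le_null => // t.
  move=> /forallP h; have [[i Ni]|nN] := pselect (exists i, N i t); first by right; exists i.
  by left => i; rewrite -WV//; move: (h i); rewrite tnth_mktuple.
move=> h; have [[i Ni]|nN] := pselect (exists i, N i t); first by right; exists i.
by left; apply/forallP => i; rewrite tnth_mktuple WV.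
Qed.

End copula_law.

Lemma copula_law (R : realType) (d : nat) (C : d.-tuple R -> R) :
  is_copula C -> C [tuple 1 | _ < d] = 1 ->
  exists dO (O : measurableType dO) (P : probability O R) (U : O -> d.-tuple R),
  [/\ measurable_fun setT U, forall t i, 0 < tnth (U t) i < 1 &
  forall u, in_cube u -> P [set t | tle (U t) u] = (C u)%:E].
Proof.
move=> hC C1.
have [|dO [T [P [K HK]]]] := @tree_process R {ffun 'I_d -> bool} [ffun=> false]
    (cell_mass C) (cell_mass_ge0 hC) _ (cell_mass_rcons C).
  by rewrite cell_mass_nil.
exists dO, T, P; apply: (copula_law_of_branch hC (K := K)) => n; by case: (HK n).
Qed.

(** * Lower orthants, quantiles and the comonotone coupling *)

(** The criterion by rays is applied to [f] on the measurable space whose sigma-algebra is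
    [<<s G >>]. *)
Lemma generated_preimage d (T : measurableType d) (R : realType)
    (G : set (set T)) (f : T -> R) :
  (forall x, <<s G >> (f @^-1` `]-oo, x]%classic)) ->
  forall A, measurable A -> <<s G >> (f @^-1` A).
Proof.
move=> fG A mA; rewrite -[X in <<s _ >> X]setTI.
exact: (@measurable_fun_lray _ (g_sigma_algebraType G) R f fG).
Qed.

Section lower_orthants.
Context (R : realType).

Section tuple.
Context (d : nat).

Definition orthant (x : d.-tuple R) : set (d.-tuple R) :=
  [set z | forall i : 'I_d, tnth z i <= tnth x i].

Lemma measurable_orthant x : measurable (orthant x).
Proof.
rewrite (_ : orthant x = \bigcap_(i in setT) ((@tnth d R)^~ i @^-1` `]-oo, tnth x i]%classic)).
  apply: fin_bigcap_measurable => // i _; rewrite -[X in measurable X]setTI.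
  exact: measurable_tnth.
apply/seteqP; split => z h i; first by move=> _; rewrite /= in_itv/=; exact: h.
by have := h i I; rewrite /= in_itv.
Qed.

Let orthants : set (set (d.-tuple R)) := range orthant.

Let measurable_orthantE : measurable = <<s orthants >>.
Proof.
apply/seteqP; split => [A mA|]; last first.
  apply: smallest_sub; first exact: sigma_algebra_measurable.
  by move=> _ [x _ <-]; exact: measurable_orthant.
move: A mA; apply: smallest_sub; first exact: smallest_sigma_algebra.
move=> A; rewrite -bigcup_seq => -[i _ [B mB <-]]; rewrite setTI.
apply: generated_preimage => // x.
(* A half-space bounding coordinate [i] is the increasing union of orthants whose other bounds tend
   to infinity. *)
rewrite (_ : _ @^-1` _ = \bigcup_n
    orthant [tuple (if j == i then x else n%:R) | j < d]); last first.
  apply/seteqP; split => [z|z [n _ h]]; rewrite /= in_itv/=; last first.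
    by move: (h i); rewrite tnth_mktuple eqxx.
  move=> zx; exists (\max_j (Num.trunc (tnth z j)).+1)%N => // j.
  rewrite tnth_mktuple; case: eqP => [->//|_].
  apply: (le_trans (ltW (truncnS_gt _))); rewrite ler_nat.
  exact: (leq_bigmax j).
apply: sigma_algebra_bigcup => n; apply: sub_sigma_algebra.
by exists [tuple (if j == i then x else n%:R) | j < d].
Qed.

(** Orthants generate the sigma-algebra, are stable under intersection by taking coordinatewise
    minima, and those with corner [(n, ..., n)] exhaust the space. *)
Lemma probability_orthant_unique (m1 m2 : probability (d.-tuple R) R) :
  (forall x, m1 (orthant x) = m2 (orthant x)) ->
  forall A, measurable A -> m1 A = m2 A.
Proof.
move=> m12 A mA; apply: (measure_unique orthants (fun n => orthant [tuple n%:R | _ < d])) => //.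
- move=> _ _ [x _ <-] [y _ <-]; exists [tuple Num.min (tnth x i) (tnth y i) | i < d] => //.
  apply/seteqP; split => z /=.
    by move=> h; split => i; move: (h i); rewrite tnth_mktuple le_min => /andP[].
  by move=> [zx zy] i; rewrite tnth_mktuple le_min zx zy.
- by move=> n; exists [tuple n%:R | _ < d].
- apply/seteqP; split => // z _; exists (\max_j (Num.trunc (tnth z j)).+1)%N => // j.
  rewrite tnth_mktuple; apply: (le_trans (ltW (truncnS_gt _))); rewrite ler_nat.
  exact: (leq_bigmax j).
- by move=> _ [x _ <-]; exact: m12.
- by move=> n; rewrite -ge0_fin_numE// fin_num_measure//; exact: measurable_orthant.
Qed.

End tuple.

Definition quadrant (x y : R) : set (R * R) := `]-oo, x] `*` `]-oo, y].

Lemma measurable_quadrant x y : measurable (quadrant x y).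
Proof. exact: measurableX. Qed.

Let quadrants : set (set (R * R)) := [set A | exists x y, A = quadrant x y].

Let measurable_quadrantE : measurable = <<s quadrants >>.
Proof.
apply/seteqP; split => [A mA|]; last first.
  apply: smallest_sub; first exact: sigma_algebra_measurable.
  by move=> _ [x [y ->]]; exact: measurable_quadrant.
move: A mA; apply: smallest_sub; first exact: smallest_sigma_algebra.
move=> A [] [B mB <-]; rewrite setTI; apply: generated_preimage => // x.
  rewrite (_ : _ @^-1` _ = \bigcup_n quadrant x n%:R); last first.
    apply/seteqP; split => [z|z [n _ []]] //=.
    rewrite /quadrant/= in_itv/= => zx; exists (Num.trunc z.2).+1 => //=.
    by rewrite !in_itv/= zx ltW// truncnS_gt.
  apply: sigma_algebra_bigcup => n; apply: sub_sigma_algebra.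
  by exists x, n%:R.
rewrite (_ : _ @^-1` _ = \bigcup_n quadrant n%:R x); last first.
  apply/seteqP; split => [z|z [n _ []]] //=.
  rewrite /quadrant/= in_itv/= => zx; exists (Num.trunc z.1).+1 => //=.
  by rewrite !in_itv/= zx ltW// truncnS_gt.
apply: sigma_algebra_bigcup => n; apply: sub_sigma_algebra.
by exists n%:R, x.
Qed.

Lemma probability_quadrant_unique (m1 m2 : probability (R * R)%type R) :
  (forall x y, m1 (quadrant x y) = m2 (quadrant x y)) ->
  forall A, measurable A -> m1 A = m2 A.
Proof.
move=> m12 A mA; apply: (measure_unique quadrants (fun n => quadrant n%:R n%:R)) => //.
- move=> _ _ [x [y ->]] [x' [y' ->]]; exists (Num.min x x'), (Num.min y y').
  apply/seteqP; split => z; rewrite /quadrant/= !in_itv/= !le_min.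
    by move=> [[-> ->] [-> ->]].
  by move=> [/andP[-> ->] /andP[-> ->]].
- by move=> n; exists n%:R, n%:R.
- apply/seteqP; split => // z _.
  exists (maxn (Num.trunc z.1).+1 (Num.trunc z.2).+1) => //; split; rewrite /= in_itv/=.
    by apply: (le_trans (ltW (truncnS_gt _))); rewrite ler_nat leq_maxl.
  by apply: (le_trans (ltW (truncnS_gt _))); rewrite ler_nat leq_maxr.
- by move=> _ [x [y ->]]; exact: m12.
- by move=> n; rewrite -ge0_fin_numE// fin_num_measure//; exact: measurable_quadrant.
Qed.

End lower_orthants.

Section quantile.
Context (R : realType) (F : R -> R).
Hypotheses (F_nd : nondecreasing_fun F) (F_rc : right_continuous F).
Hypotheses (F_Ny : F x @[x --> -oo] --> (0:R)) (F_y : F x @[x --> +oo] --> (1:R)).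

Definition quantile (u : R) : R := inf [set x | u <= F x].

(** The limits of [F] at infinity make the set of [x] with [u <= F x] nonempty and bounded below for
    [u] strictly between 0 and 1; right continuity puts its infimum in the set. *)
Lemma quantile_le u x : 0 < u < 1 -> (quantile u <= x) = (u <= F x).
Proof.
move=> /andP[u0 u1].
have ne : [set x | u <= F x] !=set0.
  have /filter_ex[y uy] : \forall y \near +oo, u <= F y by exact: cvgr_ge F_y _ u1.
  by exists y.
have lb : has_lbound [set x | u <= F x].
  have /filter_ex[y Fy] : \forall y \near -oo, F y < u by exact: cvgr_lt F_Ny _ u0.
  exists y => z /= uz.
  rewrite leNgt; apply/negP => zy.
  by move: (le_lt_trans (le_trans uz (F_nd (ltW zy))) Fy); rewrite ltxx.
apply/idP/idP => [qx|ux]; last exact: ge_inf.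
apply: le_trans (F_nd qx).
have cv : F y @[y --> (quantile u)^'+] --> F (quantile u) by exact: F_rc.
apply: (cvgr_to_ge cv); near=> y.
have [z uz zy] : exists2 z, u <= F z & z < y.
  by apply: inf_lt => //; near: y; exact: nbhs_right_gt.
exact: le_trans uz (F_nd (ltW zy)).
Unshelve. all: by end_near. Qed.

End quantile.

Section margin_df_theory.
Context (R : realType) (d : nat) (mu : probability (d.-tuple R) R) (i : 'I_d).

Lemma margin_df_quantile u x : 0 < u < 1 ->
  (quantile (margin_df mu i) u <= x) = (u <= margin_df mu i x).
Proof.
apply: quantile_le.
- by move=> a b ab; rewrite fine_le ?fin_num_measure// cdf_nondecreasing.
- move=> a; apply: fine_cvg.
  by rewrite fineK ?fin_num_measure//; exact: cdf_right_continuous.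
- exact/fine_cvg/cvg_cdfNy0.
- exact/fine_cvg/cvg_cdfy1.
Qed.

Lemma margin_dfE x : mu [set z | tnth z i <= x] = (margin_df mu i x)%:E.
Proof.
by rewrite /margin_df fineK ?fin_num_measure.
Qed.

Lemma margin_df01 x : 0 <= margin_df mu i x <= 1.
Proof.
rewrite -!lee_fin -margin_dfE measure_ge0/= probability_le1//.
rewrite (_ : mkset _ = (@tnth d R)^~ i @^-1` `]-oo, x]%classic); last first.
  by apply/seteqP; split => z /=; rewrite in_itv.
by rewrite -[X in measurable X]setTI; exact: measurable_tnth.
Qed.

End margin_df_theory.

(* For d = 0 the copula axioms alone do not force C(1, ..., 1) = 1. *)
Lemma copula_one (R : realType) (d : nat) (mu : probability (d.-tuple R) R)
    (C : d.-tuple R -> R) : is_copula C ->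
  (forall x, joint_df mu x = C [tuple margin_df mu i (tnth x i) | i < d]) ->
  C [tuple 1 | _ < d] = 1.
Proof.
move=> hC muC; have [[i _]|noi] := pselect (exists i : 'I_d, True).
  rewrite -[RHS](copula_margin hC i (t := 1)) ?ler01 ?lexx//; congr C.
  by apply: eq_from_tnth => j; rewrite !tnth_mktuple; case: ifP.
transitivity (joint_df mu [tuple 0 | _ < d]).
  rewrite muC; congr C; apply: eq_from_tnth => i; exfalso; apply: noi.
  by exists i.
rewrite /joint_df (_ : mkset _ = setT) ?probability_setT//.
by apply/seteqP; split => // z _ i; exfalso; apply: noi; exists i.
Qed.

Section optimal_coupling.
Context (R : realType) (d : nat) (C : d.-tuple R -> R) (hC : is_copula C).
Context (dO : measure_display) (T : measurableType dO) (P : probability T R).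
Context (U : T -> d.-tuple R) (mU : measurable_fun setT U).
Hypothesis U01 : forall t i, 0 < tnth (U t) i < 1.
Hypothesis PU : forall u, in_cube u -> P [set t | tle (U t) u] = (C u)%:E.

Definition quantile_transform (mu : probability (d.-tuple R) R) (t : T) : d.-tuple R :=
  [tuple quantile (margin_df mu i) (tnth (U t) i) | i < d].

Let mU_le i x : measurable [set t | tnth (U t) i <= x].
Proof.
rewrite -[X in measurable X]setTI; apply: measurable_fun_le => //.
by move/measurable_fun_tnthP : mU => /(_ i).
Qed.

Lemma quantile_transform_le mu t i x :
  (tnth (quantile_transform mu t) i <= x) = (tnth (U t) i <= margin_df mu i x).
Proof. by rewrite tnth_mktuple margin_df_quantile. Qed.

Lemma measurable_quantile_transform mu : measurable_fun setT (quantile_transform mu).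
Proof.
apply/measurable_fun_tnthP => i; apply: measurable_fun_lray => x.
rewrite (_ : _ @^-1` _ = [set t | tnth (U t) i <= margin_df mu i x])//.
by apply/seteqP; split => t; rewrite /= in_itv/= quantile_transform_le.
Qed.

(** By [quantile_transform_le] the transform lies in the orthant of [x] exactly when [U] lies below
    the vector of margins at [x], an event of probability [joint_df mu x]. *)
Lemma quantile_transform_law mu :
  (forall x, joint_df mu x = C [tuple margin_df mu i (tnth x i) | i < d]) ->
  forall A, measurable A -> P (quantile_transform mu @^-1` A) = mu A.
Proof.
move=> muC.
have mX := measurable_quantile_transform mu.
pose X : {mfun T >-> d.-tuple R} := mfun_Sub (mem_set mX).
apply: (probability_orthant_unique (m1 := distribution P X)) => x.
have -> : mu (orthant x) = (joint_df mu x)%:E.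
  by rewrite /joint_df fineK ?fin_num_measure//; exact: measurable_orthant.
rewrite muC -PU; last by move=> i; rewrite tnth_mktuple; exact: margin_df01.
congr (P _); apply/seteqP; split => t /=.
  move=> h; apply/forallP => i; rewrite tnth_mktuple -quantile_transform_le.
  exact: h.
move=> /forallP h i; move: (h i).
by rewrite tnth_mktuple -quantile_transform_le.
Qed.

Let PU_le i x : 0 <= x <= 1 -> P [set t | tnth (U t) i <= x] = x%:E.
Proof.
move=> x01; rewrite -[in RHS](copula_margin hC i x01) -PU; last first.
  by move=> j; rewrite tnth_mktuple; case: ifP => // _; rewrite ler01 lexx.
congr (P _); apply/seteqP; split => t /=.
  move=> h; apply/forallP => j; rewrite tnth_mktuple; case: eqP => [->//|_].
  by case/andP: (U01 t j) => _ /ltW.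
by move=> /forallP/(_ i); rewrite tnth_mktuple eqxx.
Qed.

(** Both transforms use the same uniform coordinate of [U], so the two conditions bound it by the
    smaller of the two margin values. *)
Lemma quantile_transform_comonotone mu nu i x y :
  P [set t | tnth (quantile_transform mu t) i <= x /\
             tnth (quantile_transform nu t) i <= y] =
  (comonotonicity (margin_df mu i x) (margin_df nu i y))%:E.
Proof.
rewrite -(PU_le i); last first.
  by rewrite /comonotonicity; case: (leP (margin_df mu i x)) => _; exact: margin_df01.
congr (P _); apply/seteqP; split => t /=; rewrite !quantile_transform_le le_min.
  by move=> [-> ->].
by move=> /andP[].
Qed.

End optimal_coupling.

Lemma exists_comonotone_coupling (R : realType) (d : nat)
    (mu nu : probability (d.-tuple R) R) : share_copula mu nu ->
  exists2 pi : probability (d.-tuple R * d.-tuple R)%type R, coupling mu nu pi &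
  forall i x y, pi [set z | tnth z.1 i <= x /\ tnth z.2 i <= y] =
    (comonotonicity (margin_df mu i x) (margin_df nu i y))%:E.
Proof.
move=> [C [hC muC nuC]].
have [dO [T [P [U [mU U01 PU]]]]] := copula_law hC (copula_one hC muC).
have mX := measurable_quantile_transform mU U01 mu.
have mY := measurable_quantile_transform mU U01 nu.
pose Z : {mfun T >-> (d.-tuple R * d.-tuple R)%type} :=
  mfun_Sub (mem_set (measurable_fun_pair mX mY)).
exists (distribution P Z) => [A mA|i x y].
- split; rewrite /distribution/= /pushforward/=.
  + rewrite -(quantile_transform_law mU U01 PU muC mA); congr (P _).
    by apply/seteqP; split => t /= => [[]|].
  + rewrite -(quantile_transform_law mU U01 PU nuC mA); congr (P _).
    by apply/seteqP; split => t /= => [[]|].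
- exact: (quantile_transform_comonotone hC U01 PU).
Qed.

(** * Submodularity of the cost and concordance *)

Section power_cost.
Context (R : realType) (p : R) (p1 : 1 <= p).

Let p0 : 0 < p. Proof. exact: lt_le_trans p1. Qed.

Definition cost (x y : R) : R := `|x - y| `^ p.

Lemma cost_ge0 x y : 0 <= cost x y.
Proof. exact: powR_ge0. Qed.

Lemma costxx x : cost x x = 0.
Proof. by rewrite /cost subrr normr0 powR0// gt_eqF. Qed.

(** Away from 0 the power is differentiable. At 0 it is squeezed between 0 and the absolute value,
    since [p >= 1]. *)
Lemma continuous_norm_powR : continuous (fun u : R => `|u| `^ p).
Proof.
move=> u; have [->|u0] := eqVneq u 0.
  rewrite /continuous_at normr0 powR0 ?gt_eqF//.
  apply: (@squeeze_cvgr _ _ _ _ (fun=> 0) (fun v : R => `|v|)); last 2 first.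
  - exact: cvg_cst.
  - by rewrite -[X in _ --> X](@normr0 _ R); exact: norm_continuous.
  near=> v.
  have v1 : `|v| < 1.
    near: v; apply: (cvgr_lt (0 : R)) => //.
    by rewrite -[X in _ --> X](@normr0 _ R); exact: norm_continuous.
  rewrite powR_ge0/=; have [->|v0] := eqVneq v 0.
    by rewrite normr0 powR0 ?gt_eqF.
  by apply: ge1r_powR => //; rewrite normr_gt0 v0/= ltW.
apply: (@continuous_comp _ _ _ (@Num.norm _ R) (@powR R ^~ p)).
  exact: norm_continuous.
apply/differentiable_continuous/derivable1_diffP/derivable_powR.
by rewrite in_itv/= normr_gt0 u0.
Unshelve. all: by end_near. Qed.

Lemma measurable_cost : measurable_fun setT (fun z : R * R => cost z.1 z.2).
Proof.
apply: (@measurableT_comp _ _ _ _ _ _ (fun u : R => `|u| `^ p)).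
  exact: continuous_measurable_fun continuous_norm_powR.
by apply: measurable_funB.
Qed.

Let norm_powR_convex (t u v : R) : 0 <= t <= 1 ->
  `|t * u + (1 - t) * v| `^ p <= t * `|u| `^ p + (1 - t) * `|v| `^ p.
Proof.
move=> t01; have /andP[t0 t1] := t01.
pose t' : {i01 R} := Itv01 (proj1 (andP t01)) (proj2 (andP t01)).
have := @convex_powR R p p1 t' `|u| `|v|.
rewrite !inE/= !in_itv/= !andbT !normr_ge0 => /(_ isT isT).
move=> h; apply: le_trans h; apply: ge0_ler_powR.
- exact: ltW.
- by rewrite nnegrE.
- rewrite nnegrE; change (0 <= t * `|u| + (1 - t) * `|v|).
  by rewrite addr_ge0// mulr_ge0// subr_ge0.
- change (`|t * u + (1 - t) * v| <= t * `|u| + (1 - t) * `|v|).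
  apply: (le_trans (ler_normD _ _)).
  by rewrite !normrM (ger0_norm t0) (@ger0_norm _ (1 - t)) ?subr_ge0.
Qed.

(** The differences [x - y] and [x' - y'] are convex combinations of [x - y'] and [x' - y] with
    exchanged weights. Adding the two convexity inequalities makes the weights sum to 1 on each
    side. *)
Lemma cost_submodular x x' y y' : x <= x' -> y <= y' ->
  cost x y + cost x' y' <= cost x y' + cost x' y.
Proof.
move=> xx yy; have [e|ne] := eqVneq (x' - y) (x - y').
  have ex : x' = x by move: e xx yy; lra.
  have ey : y' = y by move: e xx yy; lra.
  by rewrite ex ey.
pose t := (y' - y) / ((x' - y) - (x - y')).
have d0 : 0 < (x' - y) - (x - y').
  rewrite lt_neqAle eq_sym subr_eq0 ne/=; move: xx yy; lra.
have t01 : 0 <= t <= 1.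
  by rewrite divr_ge0 ?subr_ge0 ?(ltW d0)//=  ?ler_pdivrMr//; move: xx yy; lra.
have t01' : 0 <= 1 - t <= 1 by move: t01; lra.
have td : t * ((x' - y) - (x - y')) = y' - y by rewrite divfK// gt_eqF.
have h1 : x - y = (1 - t) * (x - y') + (1 - (1 - t)) * (x' - y).
  by move: td; lra.
have h2 : x' - y' = t * (x - y') + (1 - t) * (x' - y).
  by move: td; lra.
have := lerD (norm_powR_convex (x - y') (x' - y) t01')
             (norm_powR_convex (x - y') (x' - y) t01).
by rewrite -h1 -h2 /cost; lra.
Qed.

End power_cost.

Section rounding.
Context (R : realType) (a : nat -> R) (m : nat).
Hypothesis a_nd : {homo a : i j / (i <= j)%N >-> i <= j}.

(** [find] returns [m] when the search fails, so rounding up also clamps: points beyond the grid go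
    to [a m], points before it to [a 0]. *)
Definition round_index (x : R) : nat := find (fun k => x <= a k) (iota 0 m).

Definition round_up (x : R) : R := a (round_index x).

Lemma round_index_le_max x : (round_index x <= m)%N.
Proof. by rewrite -[leqRHS](size_iota 0 m) find_size. Qed.

Lemma round_index_le x k : (k < m)%N -> (round_index x <= k)%N = (x <= a k).
Proof.
move=> km; apply/idP/idP => [Nk|xk].
  have h : has (fun k => x <= a k) (iota 0 m).
    by rewrite has_find size_iota; exact: leq_ltn_trans km.
  have := nth_find 0%N h; rewrite nth_iota ?add0n; last first.
    exact: leq_ltn_trans km.
  by move=> xa; apply: (le_trans xa); exact: a_nd.
rewrite leqNgt; apply/negP => kN.
by have := before_find 0%N kN; rewrite nth_iota// add0n xk.
Qed.

Lemma round_index_nd x y : x <= y -> (round_index x <= round_index y)%N.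
Proof.
move=> xy; have [ym|ym] := ltnP (round_index y) m.
  by rewrite round_index_le// (le_trans xy)// -round_index_le.
by rewrite (leq_trans (round_index_le_max x)).
Qed.

Lemma measurable_round_up : measurable_fun setT round_up.
Proof.
by apply: nondecreasing_measurable => // x y xy; apply: a_nd; exact: round_index_nd.
Qed.

Lemma sum_ge_telescope (u : nat -> R) i : (i <= m)%N ->
  \sum_(k < m) (i <= k)%N%:R * (u k.+1 - u k) = u m - u i.
Proof.
move=> im; rewrite -(telescope_sumr u im) big_geq_mkord [RHS]big_mkcond/=.
by apply: eq_bigr => k _; case: (i <= k)%N; rewrite ?mul1r ?mul0r.
Qed.

(** The negated mixed second difference of [f] over a grid rectangle, nonnegative when [f] is
    submodular. *)
Definition grid_defect (f : R -> R -> R) (k l : nat) : R :=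
  f (a k) (a l.+1) + f (a k.+1) (a l) - f (a k) (a l) - f (a k.+1) (a l.+1).

(* Summation by parts in both variables, arranged so that for a nonnegative
   submodular f every term is nonnegative and no subtraction is integrated. *)
Lemma rounded_decomposition (f : R -> R -> R) x y : f (a m) (a m) = 0 ->
  f (round_up x) (round_up y) +
  \sum_(k < m) \sum_(l < m) grid_defect f k l * ((x <= a k)%R%:R * (y <= a l)%R%:R) =
  f (round_up x) (a m) + f (a m) (round_up y).
Proof.
move=> f0; rewrite /round_up; set i := round_index x; set j := round_index y.
have im : (i <= m)%N := round_index_le_max x.
have jm : (j <= m)%N := round_index_le_max y.
pose D k := f (a k) (a m) - f (a k) (a j).
have -> : \sum_(k < m) \sum_(l < m) grid_defect f k l * ((x <= a k)%R%:R * (y <= a l)%R%:R) =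
    - \sum_(k < m) (i <= k)%N%:R * (D k.+1 - D k).
  rewrite -sumrN; apply: eq_bigr => k _.
  pose E l := f (a k) (a l) - f (a k.+1) (a l).
  rewrite (eq_bigr (fun l : 'I_m => (x <= a k)%R%:R * ((j <= l)%N%:R * (E l.+1 - E l)))); last first.
    by move=> l _; rewrite -(round_index_le y (ltn_ord l)) /grid_defect /E -/j; ring.
  rewrite -mulr_sumr sum_ge_telescope// -(round_index_le x (ltn_ord k)) -/i /D /E; ring.
by rewrite sum_ge_telescope// /D f0; ring.
Qed.

End rounding.

Section concordance.
Context (R : realType) (p : R) (p1 : 1 <= p).

Section fixed_grid.
Context (a : nat -> R) (m : nat) (a_nd : {homo a : i j / (i <= j)%N >-> i <= j}).
Local Notation r := (round_up a m).
Local Notation D := (grid_defect a (cost p)).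

Lemma grid_defect_cost_ge0 k l : 0 <= D k l.
Proof.
have := @cost_submodular R p p1 (a k) (a k.+1) (a l) (a l.+1) (a_nd (leqnSn k)) (a_nd (leqnSn l)).
rewrite /grid_defect; lra.
Qed.

Let measurable_rounded : measurable_fun setT (fun z : R * R => cost p (r z.1) (r z.2)).
Proof.
apply: (measurableT_comp (measurable_cost p1) (g := (fun z => (r z.1, r z.2)))).
apply: measurable_fun_pair; apply: measurableT_comp => //; exact: measurable_round_up.
Qed.

Let measurable_first : measurable_fun setT (fun x : R => cost p (r x) (a m)).
Proof.
apply: (measurableT_comp (measurable_cost p1) (g := (fun x => (r x, a m)))).
by apply: measurable_fun_pair => //; exact: measurable_round_up.
Qed.

Let measurable_second : measurable_fun setT (fun y : R => cost p (a m) (r y)).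
Proof.
apply: (measurableT_comp (measurable_cost p1) (g := (fun y => (a m, r y)))).
by apply: measurable_fun_pair => //; exact: measurable_round_up.
Qed.

(** Integrating [rounded_decomposition] leaves on the right only the margins of [P]; on the left [P]
    enters the correction only through its distribution function at grid points. *)
Let integral_rounded (P : probability (R * R)%type R) :
  (\int[P]_z (cost p (r z.1) (r z.2))%:E +
   (\sum_(k < m) \sum_(l < m) D k l * fine (P (quadrant (a k) (a l))))%:E =
   \int[pushforward P fst]_x (cost p (r x) (a m))%:E +
   \int[pushforward P snd]_y (cost p (a m) (r y))%:E)%E.
Proof.
have mq k l := measurable_quadrant (a k) (a l).
have -> : (\sum_(k < m) \sum_(l < m) D k l * fine (P (quadrant (a k) (a l))))%:E =
  (\int[P]_z (\sum_(k < m) \sum_(l < m) D k l * \1_(quadrant (a k) (a l)) z)%:E)%E.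
  under eq_integral do rewrite -sumEFin.
  rewrite ge0_integral_sum//; last 2 first.
  - move=> k; apply/measurable_EFinP; apply: measurable_sum => l.
    by apply: measurable_funM => //; exact: measurable_indic.
  - by move=> k z _; rewrite lee_fin sumr_ge0// => l _; rewrite mulr_ge0// grid_defect_cost_ge0.
  rewrite -sumEFin; apply: eq_bigr => k _.
  under eq_integral do rewrite -sumEFin.
  rewrite ge0_integral_sum//; last 2 first.
  - move=> l; apply/measurable_EFinP.
    by apply: measurable_funM => //; exact: measurable_indic.
  - by move=> l z _; rewrite lee_fin mulr_ge0// grid_defect_cost_ge0.
  rewrite -sumEFin; apply: eq_bigr => l _.
  under eq_integral do rewrite EFinM.
  rewrite ge0_integralZl_EFin//; last 2 first.
  - by apply/measurable_EFinP; exact: measurable_indic.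
  - exact: grid_defect_cost_ge0.
  by rewrite integral_indic// setIT EFinM fineK ?fin_num_measure.
rewrite !ge0_integral_pushforward//; last 4 first.
- exact/measurable_EFinP.
- by move=> y _; rewrite lee_fin cost_ge0.
- exact/measurable_EFinP.
- by move=> y _; rewrite lee_fin cost_ge0.
rewrite !preimage_setT -!ge0_integralD//=; last 8 first.
- by move=> z _; rewrite lee_fin cost_ge0.
- exact/measurable_EFinP.
- move=> z _; rewrite lee_fin sumr_ge0// => k _; rewrite sumr_ge0// => l _.
  by rewrite mulr_ge0// grid_defect_cost_ge0.
- apply/measurable_EFinP; apply: measurable_sum => k; apply: measurable_sum => l.
  by apply: measurable_funM => //; exact: measurable_indic.
- by move=> z _; rewrite lee_fin cost_ge0.
- by apply: measurableT_comp => //; exact/measurable_EFinP.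
- by move=> z _; rewrite lee_fin cost_ge0.
- by apply: measurableT_comp => //; exact/measurable_EFinP.
apply: eq_integral => -[x y] _ /=; rewrite -!EFinD; congr EFin.
rewrite -(rounded_decomposition a_nd x y (costxx p1 (a m))); congr (_ + _).
apply: eq_bigr => k _; apply: eq_bigr => l _; congr (_ * _).
rewrite indicE -natrM mulnb; congr (_%:R); congr nat_of_bool.
by apply/idP/andP => [|[xa ya]]; rewrite inE /quadrant/= !in_itv/=.
Qed.

Lemma rounded_cost_le (P Q : probability (R * R)%type R) :
  (forall A, measurable A -> P (fst @^-1` A) = Q (fst @^-1` A)) ->
  (forall A, measurable A -> P (snd @^-1` A) = Q (snd @^-1` A)) ->
  (forall x y, P (quadrant x y) <= Q (quadrant x y))%E ->
  (\int[Q]_z (cost p (r z.1) (r z.2))%:E <= \int[P]_z (cost p (r z.1) (r z.2))%:E)%E.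
Proof.
move=> PQ1 PQ2 PQ.
(* The correction for [Q] is finite, so it may be added to both sides. With equal margins, the claim
   becomes that the correction for [P] is at most [S]. *)
set S := (\sum_(k < m) \sum_(l < m) D k l * fine (Q (quadrant (a k) (a l))))%:E.
rewrite -(@leeD2rE _ S)// [leLHS]integral_rounded.
rewrite (@eq_measure_integral _ _ _ _ (pushforward P fst) (pushforward Q fst)); last first.
  by move=> A mA _; exact/esym/PQ1.
rewrite (@eq_measure_integral _ _ _ _ (pushforward P snd) (pushforward Q snd)); last first.
  by move=> A mA _; exact/esym/PQ2.
rewrite -integral_rounded leeD2l// lee_fin; apply: ler_sum => k _; apply: ler_sum => l _.
rewrite ler_wpM2l ?grid_defect_cost_ge0// fine_le ?fin_num_measure//; exact: measurable_quadrant.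
Qed.

Section mesh.
Context (h : R) (h0 : 0 <= h) (a_step : forall k, a k.+1 <= a k + h).

Let round_up_lt x : r x = a 0 \/ r x <= x + h.
Proof.
rewrite /round_up; case E : (round_index a m x) => [|k]; [by left|right].
have km : (k < m)%N by rewrite -E round_index_le_max.
apply: (le_trans (a_step k)); rewrite lerD2r leNgt; apply/negP => /ltW.
by rewrite -(round_index_le a_nd x km) E ltnn.
Qed.

Let round_up_ge x : r x = a m \/ x <= r x.
Proof.
rewrite /round_up; have [xm|mx] := ltnP (round_index a m x) m.
  by right; rewrite -(round_index_le a_nd x xm).
by left; congr a; apply/eqP; rewrite eqn_leq mx round_index_le_max.
Qed.

Let round_up_bound x : a 0 <= r x <= a m.
Proof. by rewrite !a_nd// round_index_le_max. Qed.

Lemma round_up_near x : a 0 <= x <= a m -> x <= r x <= x + h.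
Proof.
move=> /andP[ax xa]; apply/andP; split.
  by have [->|] := round_up_ge x.
have [->|//] := round_up_lt x; move: h0 ax; lra.
Qed.

(** Clamping does not increase distances and rounding up shifts a point by at most [h]. Holding off
    the grid range too, the bound provides a dominating function. *)
Lemma round_up_contract x y : `|r x - r y| <= `|x - y| + h.
Proof.
wlog xy : x y / x <= y.
  by move=> H; have [/H//|/ltW/H] := leP x y; rewrite distrC (distrC y).
have rxy : r x <= r y by apply: a_nd; exact: round_index_nd.
rewrite distrC ger0_norm ?subr_ge0// distrC ger0_norm ?subr_ge0//.
have /andP[ax xa] := round_up_bound x; have /andP[ay ya] := round_up_bound y.
have [rx|rx] := round_up_ge x; have [ry|ry] := round_up_lt y;
  move: (r x) (r y) (a 0) (a m) rx ry ax ya h0 xy => rx ry a0 am; lra.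
Qed.

End mesh.

End fixed_grid.

(** A grid of step 1/(n+1) from -n to n, the latter at index 2n(n+1): it gets finer and wider
    together. *)
Let grid n k : R := k%:R / n.+1%:R - n%:R.

Let grid_nd n : {homo grid n : i j / (i <= j)%N >-> i <= j}.
Proof. by move=> i j ij; rewrite /grid lerD2r ler_pM2r ?invr_gt0// ler_nat. Qed.

Let grid_step n k : grid n k.+1 <= grid n k + n.+1%:R^-1.
Proof. by rewrite /grid -[k.+1%:R]natr1 mulrDl mul1r addrAC. Qed.

Let grid_first n : grid n 0 = - n%:R.
Proof. by rewrite /grid mul0r add0r. Qed.

Let grid_last n : grid n (n.*2 * n.+1) = n%:R.
Proof. by rewrite /grid natrM mulfK// -addnn natrD addrK. Qed.

Let rnd n := round_up (grid n) (n.*2 * n.+1).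

Let rnd_cvg x : rnd n x @[n --> \oo] --> x.
Proof.
apply: (@squeeze_cvgr _ _ _ _ (fun=> x) (fun n => x + n.+1%:R^-1)).
- near=> n; have xn : `|x| <= n%:R by near: n; exact: nbhs_infty_ger.
  apply: (round_up_near (grid_nd n) _ (grid_step n)) => //.
  by rewrite grid_first grid_last -ler_norml.
- exact: cvg_cst.
- rewrite -[X in _ --> X]addr0; apply: cvgD; first exact: cvg_cst.
  exact: cvg_harmonic.
Unshelve. all: by end_near. Qed.

(** The sum [c + 1] is at most twice the larger of [c] and 1. *)
Lemma powR_addr1_le (c : R) : 0 <= c -> (c + 1) `^ p <= 2 `^ p * (c `^ p + 1).
Proof.
move=> c0; have p0 : 0 <= p by rewrite (le_trans _ p1).
have [c1|c1] := leP c 1.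
  apply: (@le_trans _ _ (2 `^ p)).
    by apply: ge0_ler_powR => //; rewrite ?nnegrE; lra.
  by rewrite ler_peMr ?powR_ge0// lerDr powR_ge0.
apply: (@le_trans _ _ (2 `^ p * c `^ p)).
  rewrite -powRM//; apply: ge0_ler_powR => //; rewrite ?nnegrE; lra.
by rewrite ler_wpM2l ?powR_ge0// lerDl.
Qed.

(** The rounded inequalities pass to the limit differently on each side: Fatou's lemma for [Q],
    dominated convergence for [P], whose cost may be assumed finite. *)
Lemma integral_cost_concordance (P Q : probability (R * R)%type R) :
  (forall A, measurable A -> P (fst @^-1` A) = Q (fst @^-1` A)) ->
  (forall A, measurable A -> P (snd @^-1` A) = Q (snd @^-1` A)) ->
  (forall x y, P (quadrant x y) <= Q (quadrant x y))%E ->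
  (\int[Q]_z (cost p z.1 z.2)%:E <= \int[P]_z (cost p z.1 z.2)%:E)%E.
Proof.
move=> PQ1 PQ2 PQ; have p0 : 0 <= p by rewrite (le_trans _ p1).
pose f n (z : R * R) := (cost p (rnd n z.1) (rnd n z.2))%:E.
pose g (z : R * R) := (2 `^ p * (cost p z.1 z.2 + 1))%:E.
have mf n : measurable_fun setT (f n).
  apply/measurable_EFinP.
  apply: (measurableT_comp (measurable_cost p1) (g := (fun z => (rnd n z.1, rnd n z.2)))).
  apply: measurable_fun_pair; apply: measurableT_comp => //.
    exact: measurable_round_up (grid_nd n).
  exact: measurable_round_up (grid_nd n).
have f_cvg z : f ^~ z @ \oo --> (cost p z.1 z.2)%:E.
  apply: cvg_EFin; first by near=> n.
  apply: (@cvg_comp _ _ _ (fun n => rnd n z.1 - rnd n z.2) (fun u : R => `|u| `^ p)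
    _ (nbhs (z.1 - z.2))); last exact: continuous_norm_powR.
  by apply: cvgB; exact: rnd_cvg.
have f0 n z : setT z -> (0 <= f n z)%E by move=> _; rewrite lee_fin cost_ge0.
have mc : measurable_fun setT (fun z : R * R => (cost p z.1 z.2)%:E).
  by apply/measurable_EFinP; exact: measurable_cost.
have [Poo|Pfin] := eqVneq (\int[P]_z (cost p z.1 z.2)%:E)%E +oo%E.
  by rewrite Poo leey.
have ig : P.-integrable setT g.
  apply/integrableP; split.
    apply/measurable_EFinP; apply: measurable_funM => //.
    by apply: measurable_funD => //; exact: measurable_cost.
  under eq_integral do rewrite /g gee0_abs ?lee_fin ?mulr_ge0 ?addr_ge0 ?powR_ge0//.
  under eq_integral do rewrite EFinM.
  rewrite ge0_integralZl_EFin//; last 2 first.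
  - by move=> z _; rewrite lee_fin addr_ge0 ?cost_ge0.
  - by apply/measurable_EFinP; apply: measurable_funD => //; exact: measurable_cost.
  apply: lte_mul_pinfty; rewrite ?lee_fin ?powR_ge0//.
  under eq_integral do rewrite EFinD.
  rewrite ge0_integralD//; last by move=> z _; rewrite lee_fin cost_ge0.
  rewrite integral_cst// lte_add_pinfty//; first by rewrite lt_neqAle Pfin leey.
  by rewrite mul1e -ge0_fin_numE// fin_num_measure.
have fg n z : setT z -> (`|f n z| <= g z)%E.
  move=> _; rewrite gee0_abs ?f0// lee_fin; apply: le_trans (powR_addr1_le _) => //.
  rewrite /cost; apply: ge0_ler_powR => //; rewrite ?nnegrE//.
  have Vn : 0 <= n.+1%:R^-1 :> R by rewrite invr_ge0.
  have c := @round_up_contract _ (n.*2 * n.+1) (grid_nd n) _ Vn (grid_step n) z.1 z.2.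
  apply: (le_trans c).
  by rewrite lerD2l invf_le1// ler1n.
have Pcvg : (\int[P]_z f n z)%E @[n --> \oo] --> (\int[P]_z (cost p z.1 z.2)%:E)%E.
  apply: (@dominated_cvg _ _ _ P setT measurableT f _ g) => //.
have -> : (\int[Q]_z (cost p z.1 z.2)%:E = \int[Q]_z limn_einf (f ^~ z))%E.
  by apply: eq_integral => z _; rewrite (cvg_limn_einf_sup (f_cvg z)).
apply: (le_trans (fatou Q measurableT mf f0)).
rewrite limn_einf_lim -(cvg_lim _ Pcvg)//.
apply: lee_lim.
- exact: is_cvg_einfs.
- by apply/cvg_ex; eexists; exact: Pcvg.
near=> n; apply: (@le_trans _ _ (\int[Q]_z f n z)%E).
  by apply: ereal_inf_lbound; exists n => //=.
exact: (@rounded_cost_le _ (n.*2 * n.+1) (grid_nd n) P Q PQ1 PQ2 PQ).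
Unshelve. all: by end_near. Qed.

End concordance.

(** * Optimal transport cost *)

Lemma powR_lpnorm (R : realType) (d : nat) (p : R) (x y : d.-tuple R) : 0 < p ->
  lpnorm p (vsub x y) `^ p = \sum_(i < d) cost p (tnth x i) (tnth y i).
Proof.
move=> p0; rewrite /lpnorm -powRrM mulVf ?gt_eqF// powRr1; last first.
  by apply: sumr_ge0 => i _; exact: powR_ge0.
by apply: eq_bigr => i _; rewrite /vsub tnth_mktuple.
Qed.

(** The infimum is nonnegative, so raising its root to the power [p] recovers it even when it is
    infinite. *)
Lemma poweR_wasserstein (R : realType) (d : nat) (p : R)
    (mu nu : probability (d.-tuple R) R) : 0 < p ->
  (poweR (wasserstein p mu nu) p = ereal_inf
    [set \int[pi]_z (lpnorm p (vsub z.1 z.2) `^ p)%:E | pi in coupling mu nu])%E.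
Proof.
move=> p0; rewrite /wasserstein -poweRrM mulVf ?gt_eqF// poweRe1//.
apply/ereal_infP => _ [pi _ <-]; apply: integral_ge0 => z _.
by rewrite lee_fin powR_ge0.
Qed.

Section coordinate_laws.
Context (R : realType) (d : nat).
Implicit Types (pi : probability (d.-tuple R * d.-tuple R)%type R).

Definition coord_pair (i : 'I_d) (z : d.-tuple R * d.-tuple R) : R * R :=
  (tnth z.1 i, tnth z.2 i).

Lemma measurable_coord_pair i : measurable_fun setT (coord_pair i).
Proof.
apply: measurable_fun_pair.
  exact: (measurableT_comp (measurable_tnth i) measurable_fst).
exact: (measurableT_comp (measurable_tnth i) measurable_snd).
Qed.

HB.instance Definition _ (i : 'I_d) :=
  isMeasurableFun.Build _ _ _ _ (coord_pair i) (measurable_coord_pair i).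

Definition coord_law pi (i : 'I_d) : probability (R * R)%type R :=
  distribution pi (coord_pair i).

Lemma integral_lpnorm_coord_law pi (p : R) : 1 <= p ->
  (\int[pi]_z (lpnorm p (vsub z.1 z.2) `^ p)%:E =
   \sum_(i < d) \int[coord_law pi i]_z (cost p z.1 z.2)%:E)%E.
Proof.
move=> p1; have p0 : 0 < p by exact: lt_le_trans p1.
under eq_integral do rewrite powR_lpnorm// -sumEFin.
have mc i : measurable_fun setT (fun z : d.-tuple R * d.-tuple R =>
    (cost p (tnth z.1 i) (tnth z.2 i))%:E).
  apply/measurable_EFinP.
  exact: (measurableT_comp (measurable_cost p1) (measurable_coord_pair i)).
rewrite ge0_integral_sum//; last by move=> i z _; rewrite lee_fin cost_ge0.
apply: eq_bigr => i _; rewrite ge0_integral_distribution//.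
- by apply/measurable_EFinP; exact: measurable_cost.
- by move=> z; rewrite lee_fin cost_ge0.
Qed.

Section coupling.
Context (mu nu : probability (d.-tuple R) R) (pi : probability (d.-tuple R * d.-tuple R)%type R).
Hypothesis cpi : coupling mu nu pi.
Context (i : 'I_d).

Let measurable_tnth_preim (A : set R) : measurable A ->
  measurable ((@tnth d R)^~ i @^-1` A).
Proof. by move=> mA; rewrite -[X in measurable X]setTI; exact: measurable_tnth. Qed.

Lemma coord_law_fst A : measurable A ->
  coord_law pi i (fst @^-1` A) = mu ((@tnth d R)^~ i @^-1` A).
Proof.
move=> mA; rewrite -(cpi (measurable_tnth_preim mA)).1; congr (pi _).
by apply/seteqP; split => z //= -[].
Qed.

Lemma coord_law_snd A : measurable A ->
  coord_law pi i (snd @^-1` A) = nu ((@tnth d R)^~ i @^-1` A).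
Proof.
move=> mA; rewrite -(cpi (measurable_tnth_preim mA)).2; congr (pi _).
by apply/seteqP; split => z //= -[].
Qed.

(** The upper Fréchet-Hoeffding bound: a quadrant lies in a vertical and in a horizontal half-plane,
    whose masses are the margins. *)
Lemma coord_law_quadrant_le x y : (coord_law pi i (quadrant x y) <=
  (comonotonicity (margin_df mu i x) (margin_df nu i y))%:E)%E.
Proof.
have mray (t : R) : measurable `]-oo, t]%classic by [].
rewrite /comonotonicity EFin_min le_min -!margin_dfE; apply/andP; split.
  rewrite (_ : [set z | _] = (@tnth d R)^~ i @^-1` `]-oo, x]%classic); last first.
    by apply/seteqP; split => z /=; rewrite in_itv.
  rewrite -coord_law_fst//; apply: le_measure; rewrite ?inE.
  - exact: measurable_quadrant.
  - by rewrite -[X in measurable X]setTI; exact: measurable_fst.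
  - by move=> z [].
rewrite (_ : [set z | _] = (@tnth d R)^~ i @^-1` `]-oo, y]%classic); last first.
  by apply/seteqP; split => z /=; rewrite in_itv.
rewrite -coord_law_snd//; apply: le_measure; rewrite ?inE.
- exact: measurable_quadrant.
- by rewrite -[X in measurable X]setTI; exact: measurable_snd.
- by move=> z [].
Qed.

End coupling.

(** [coord_law pi i] witnesses that the choice in [measure_of_df2] is not the default, and quadrants
    determine the measure. *)
Lemma comonotone_measure_coord_law (F G : R -> R) pi i :
  (forall x y, coord_law pi i (quadrant x y) = (comonotonicity (F x) (G y))%:E) ->
  forall A, measurable A -> comonotone_measure F G A = coord_law pi i A.
Proof.
move=> FG; apply: probability_quadrant_unique => x y; rewrite FG.
exact: (@getPex _ [set m : probability (R * R)%type R | forall x y : R,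
  m (`]-oo, x] `*` `]-oo, y]) = (comonotonicity (F x) (G y))%:E]
  (ex_intro _ (coord_law pi i) FG)).
Qed.

End coordinate_laws.

Theorem theorem3p7 (R : realType) (d : nat) (p : R)
    (mu nu : probability (d.-tuple R) R)
    (hp : 1 <= p)
    (hmu : finite_moment p mu) (hnu : finite_moment p nu)
    (hC : share_copula mu nu) :
  (poweR (wasserstein p mu nu) p =
   \sum_(i < d)
     \int[comonotone_measure (margin_df mu i) (margin_df nu i)]_z
       (`|z.1 - z.2| `^ p)%:E)%E.
Proof.
have p0 : 0 < p by exact: lt_le_trans hp.
rewrite poweR_wasserstein//.
have [pi0 cpi0 pi0E] := exists_comonotone_coupling hC.
have pi0q i x y : coord_law pi0 i (quadrant x y) =
    (comonotonicity (margin_df mu i x) (margin_df nu i y))%:E.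
  by rewrite -pi0E; congr (pi0 _).
have -> : (\sum_(i < d) \int[comonotone_measure (margin_df mu i) (margin_df nu i)]_z
      (`|z.1 - z.2| `^ p)%:E =
    \sum_(i < d) \int[coord_law pi0 i]_z (cost p z.1 z.2)%:E)%E.
  apply: eq_bigr => i _; apply: eq_measure_integral => A mA _.
  exact: (comonotone_measure_coord_law (pi0q i)).
(* [pi0] attains the sum, which bounds the infimum above; the reverse bound compares each coordinate
   law of an arbitrary coupling with that of [pi0]. *)
apply/eqP; rewrite eq_le; apply/andP; split.
  rewrite -integral_lpnorm_coord_law//.
  by apply: ereal_inf_lbound; exists pi0.
apply/ereal_infP => _ [pi cpi <-]; rewrite integral_lpnorm_coord_law//.
apply: lee_sum => i _; apply: integral_cost_concordance => //.
- by move=> A mA; rewrite (coord_law_fst cpi)// (coord_law_fst cpi0).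
- by move=> A mA; rewrite (coord_law_snd cpi)// (coord_law_snd cpi0).
- by move=> x y; rewrite pi0q; exact: coord_law_quadrant_le.
Qed.
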